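(* Let $\mathbb{P}=(P,\omega^\omega,\cdot)$ be a relative partial combinatory algebra and $\mathbf{j}$ an idempotent jump operator on $\mathbb{P}$. Then every axiom of intuitionistic Zermelo–Fraenkel set theory $\mathbf{IZF}$ is $\mathbf{j}$-realizable over $\mathbb{P}_\mathbf{j}$.
   Context: A relative pca is $(P,\omega^\omega,\cdot)$ with $P\subseteq\omega^\omega$ such that $(\omega^\omega,\cdot)$ and $(P,\cdot|_P)$ are partial combinatory algebras sharing combinators $\mathsf{s},\mathsf{k}$. Composition: $(h\circ g)(x)=\bigcup\{h(y):y\in g(x)\}$ if $g(x)$ defined and $\subseteq\mathrm{dom}(h)$, else undefined; $a\mathbf{j}(x)=\{a\cdot y:y\in\mathbf{j}(x)\}$. $\mathbf{j}\colon\subseteq\omega^\omega\rightrightarrows\omega^\omega$ is an idempotent jump operator if (1) there is $u\in P$ with $a\mathbf{j}(x)=\mathbf{j}(uax)$; (2) there is $\iota\in P$ with $\{x\}=\mathbf{j}(\iota x)$; (3) there is $j_0\in P$ with $\mathbf{j}\circ\mathbf{j}(x)=\mathbf{j}(j_0x)$ (for all $a,x$). If $\mathbf{j}(a)$ is a singleton, $a'$ is its element; $a\ast_\mathbf{j}b\simeq a'\cdot b$ (undefined if $\mathbf{j}(a)$ is not a singleton); $P_\mathbf{j}=\{a':a\in P,\ \mathbf{j}(a)\text{ a singleton}\}$; $\mathbb{P}_\mathbf{j}=(P_\mathbf{j},\omega^\omega,\ast_\mathbf{j})$. Realizability over $\mathbb{P}_\mathbf{j}$: in a universe with a set $\mathbb{N}$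 of urelements, let $V_\alpha=\bigcup_{\beta<\alpha}\mathcal{P}(\omega^\omega\times(V_\beta\cup\mathbb{N}))$, $V_{\rm set}=\bigcup_\alpha V_\alpha$, $V=V_{\rm set}\cup\mathbb{N}$. Sentences of the language of IZF (with predicates $\mathbf{N}$, $\mathbf{Set}$, primitive recursive relations $R$) with parameters in $V$. Applications below are $\ast_\mathbf{j}$, with pairing projections $\pi_0,\pi_1$ and numerals $\underline{n}$; $\forall^+x\in X\,A$ means $X\ne\emptyset$ and $\forall x\in X\,A$. For $e\in\omega^\omega$: $e\Vdash R(\bar a)$ iff $\mathbb{N}\models R(\bar a)$; $e\Vdash\mathbf{N}(a)$ iff $a\in\mathbb{N}$, $e=\underline a$; $e\Vdash\mathbf{Set}(a)$ iff $a\in V_{\rm set}$; $e\Vdash a\in b$ iff $\forall^+d\in\mathbf{j}(e)\exists c[(\pi_0d,c)\in b\wedge\pi_1d\Vdash a=c]$; $e\Vdash a=b$ iff ($a,b\in\mathbb{N}$, $a=b$) or ($a,b\in V_{\rm set}$ and $\forall^+d\in\mathbf{j}(e)$: for all $(p,c)\in a$, $(\pi_0d)p\Vdash c\in b$, and for all $(p,c)\in b$, $(\pi_1d)p\Vdash c\in a$); $e\Vdash A\wedge B$ iff $\pi_0e\Vdash A$ and $\pi_1e\Vdash B$; $e\Vdash A\vee B$ iff $\forall^+d\in\mathbf{j}(e)[(\pi_0d=0\wedge\pi_1d\Vdash A)\vee(\pi_0d=1\wedge\pi_1d\Vdash B)]$; $e\Vdash\neg A$ iff no $a\in\omega^\omega$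 realizes $A$; $e\Vdash A\to B$ iff $a\Vdash A$ implies $ea\Vdash B$ for all $a$; $e\Vdash\forall xA$ iff $\forall^+d\in\mathbf{j}(e)\forall c\in V\ d\Vdash A[c/x]$; $e\Vdash\exists xA$ iff $\forall^+d\in\mathbf{j}(e)\exists c\in V\ d\Vdash A[c/x]$. A sentence is $\mathbf{j}$-realizable over $\mathbb{P}_\mathbf{j}$ if some $e\in P_\mathbf{j}$ realizes it.
   Formalization: The formal theorem additionally assumes that ℙ_j, with a∗b ≃ a′·b, is itself a relative pca (for any choice of its combinators s, k, from which projections and numerals are formed); this fails for some idempotent jump operators, e.g. one closing Kleene's second algebra under limits. *)

(* Defs.v *)
From mathcomp Require Import all_boot.
From mathcomp Require Import boolp classical_sets.
Set Implicit Arguments.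
Unset Strict Implicit.
Unset Printing Implicit Defensive.
Local Open Scope classical_set_scope.

Definition baire := nat -> nat.

Definition papp := baire -> baire -> option baire.

Definition lapp (ap : papp) (x y : option baire) : option baire :=
  obind (fun a => obind (ap a) y) x.

(* [s] is required to satisfy: if ac(bc) is defined, then so is sabc and they
   are equal.  This is implied by Kleene equality sabc = ac(bc). *)
Record combinators (P : set baire) (ap : papp) (s k : baire) : Prop :=
  Combinators {
    comb_s_in : P s;
    comb_k_in : P k;
    comb_closed : forall a b c, P a -> P b -> ap a b = Some c -> P c;
    comb_k : forall a b, lapp ap (ap k a) (Some b) = Some a;
    comb_s_def : forall a b, lapp ap (ap s a) (Some b) <> None;
    comb_s : forall a b c d,
      lapp ap (ap a c) (ap b c) = Some d ->
      lapp ap (lapp ap (ap s a) (Some b)) (Some c) = Some d }.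

Definition relative_pca (P : set baire) (ap : papp) : Prop :=
  exists s k, combinators P ap s k.

(* Partial multimaps: [None] is "undefined", which differs from having the
   empty set as value. *)
Definition mmap := baire -> option (set baire).

Definition mdom (f : mmap) : set baire := [set x | f x <> None].

Definition mcomp (h g : mmap) : mmap := fun x =>
  if g x is Some Y then
    if `[< Y `<=` mdom h >] then
      Some [set z | exists2 y, Y y & exists2 Z, h y = Some Z & Z z]
    else None
  else None.

(* x |-> {a . y : y in j(x)}; undefined as soon as j(x) or some a . y is. *)
Definition mscale (ap : papp) (a : baire) (j : mmap) : mmap :=
  mcomp (fun y => omap (fun z => [set z]) (ap a y)) j.

Definition idempotent_jump (P : set baire) (ap : papp) (j : mmap) : Prop :=
  [/\ exists2 u, P u & forall a x,
        mscale ap a j x = obind j (lapp ap (ap u a) (Some x)),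
      exists2 i, P i & forall x, Some [set x] = obind j (ap i x)
    & exists2 j0, P j0 & forall x, mcomp j j x = obind j (ap j0 x)].

(* The element a' of j(a), when j(a) is a singleton. *)
Definition jelt (j : mmap) (a : baire) : option baire :=
  if pselect (exists y, j a = Some [set y]) is left h
  then Some (projT1 (cid h)) else None.

Definition japp (ap : papp) (j : mmap) : papp :=
  fun a b => obind (fun a' => ap a' b) (jelt j a).

Definition jpart (P : set baire) (j : mmap) : set baire :=
  [set y | exists2 a, P a & jelt j a = Some y].

(* Standard encodings in a pca, written with [s] and [k] (bracket
   abstraction): i = skk, <a,b> = \z.zab, pi_0 = \z.zk, pi_1 = \z.z(ki),
   and Curry numerals 0 = i, n+1 = <ki,n>. *)
Section Encodings.
Variables (ap : papp) (s k : baire).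
Local Notation "x @@ y" := (lapp ap x y) (at level 40, left associativity).
Local Notation S := (Some s).
Local Notation K := (Some k).

Definition cI : option baire := S @@ K @@ K.
Definition cKI : option baire := K @@ cI.
Definition cpair (x y : option baire) : option baire :=
  S @@ (S @@ cI @@ (K @@ x)) @@ (K @@ y).
Definition proj0 (x : option baire) : option baire :=
  (S @@ cI @@ (K @@ K)) @@ x.
Definition proj1 (x : option baire) : option baire :=
  (S @@ cI @@ (K @@ cKI)) @@ x.
Fixpoint numeral (n : nat) : option baire :=
  if n is m.+1 then cpair cKI (numeral m) else cI.
End Encodings.

(* The universe V = V_set u N.  [USet p c] is the set of pairs (p i, c i). *)
Inductive universe : Type :=
| UNat of nat
| USet (X : Type) (p : X -> baire) (c : X -> universe).

Definition is_uset (a : universe) : Prop :=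
  if a is USet _ _ _ then True else False.

Definition inpair (p : baire) (c b : universe) : Prop :=
  if b is USet X q d then exists i : X, q i = p /\ d i = c else False.

(* Variables in context n: [None] is the innermost bound variable. *)
Fixpoint vars (n : nat) : Type := if n is m.+1 then option (vars m) else void.

Definition scons T n (c : T) (rho : vars n -> T) : vars n.+1 -> T :=
  fun x => if x is Some y then rho y else c.

Inductive prf : nat -> Type :=
| PZero : prf 0
| PSucc : prf 1
| PProj n of vars n : prf n
| PComp n m of prf m & (vars m -> prf n) : prf n
| PRec n of prf n & prf n.+2 : prf n.+1.

Fixpoint prf_eval n (f : prf n) : (vars n -> nat) -> nat :=
  match f in prf n return (vars n -> nat) -> nat with
  | PZero => fun _ => 0
  | PSucc => fun xs => (xs None).+1
  | PProj _ i => fun xs => xs i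
  | PComp _ _ f g => fun xs => prf_eval f (fun i => prf_eval (g i) xs)
  | PRec n f g => fun xs =>
      let ys : vars n -> nat := fun i => xs (Some i) in
      (fix rec m := if m is m'.+1
        then @prf_eval n.+2 g (scons m' (scons (rec m') ys : vars n.+1 -> nat))
        else prf_eval f ys) (xs None)
  end.

(* Symbols for the primitive recursive relations: f(x) = 0, and, separately
   named, the graph f(x) = y (where y is the variable [None]). *)
Inductive prel : nat -> Type :=
| RZero n of prf n : prel n
| RGraph n of prf n : prel n.+1.

Definition prel_holds n (R : prel n) : (vars n -> nat) -> Prop :=
  match R in prel n return (vars n -> nat) -> Prop with
  | RZero _ f => fun xs => prf_eval f xs = 0
  | RGraph _ f => fun xs => prf_eval f (fun i => xs (Some i)) = xs None
  end.

Inductive form : nat -> Type :=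
| FRel n k of prel k & (vars k -> vars n) : form n
| FNat n of vars n : form n
| FSet n of vars n : form n
| FMem n of vars n & vars n : form n
| FEq n of vars n & vars n : form n
| FAnd n of form n & form n : form n
| FOr n of form n & form n : form n
| FNot n of form n : form n
| FImp n of form n & form n : form n
| FAll n of form n.+1 : form n
| FEx n of form n.+1 : form n.

Definition sentence := form 0.

Fixpoint ren n m (f : vars n -> vars m) (A : form n) : form m :=
  match A in form n return (vars n -> vars m) -> form m with
  | FRel _ _ R v => fun f => FRel R (fun i => f (v i))
  | FNat _ x => fun f => FNat (f x)
  | FSet _ x => fun f => FSet (f x)
  | FMem _ x y => fun f => FMem (f x) (f y)
  | FEq _ x y => fun f => FEq (f x) (f y)
  | FAnd _ B C => fun f => FAnd (ren f B) (ren f C)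
  | FOr _ B C => fun f => FOr (ren f B) (ren f C)
  | FNot _ B => fun f => FNot (ren f B)
  | FImp _ B C => fun f => FImp (ren f B) (ren f C)
  | FAll n B => fun f => FAll (@ren n.+1 m.+1 (omap f) B)
  | FEx n B => fun f => FEx (@ren n.+1 m.+1 (omap f) B)
  end f.

Definition FIff n (A B : form n) : form n := FAnd (FImp A B) (FImp B A).
Definition FAllSet n (A : form n.+1) : form n :=
  FAll (FImp (@FSet n.+1 None) A).
Definition FExSet n (A : form n.+1) : form n :=
  FEx (FAnd (@FSet n.+1 None) A).
Definition FAllNat n (A : form n.+1) : form n :=
  FAll (FImp (@FNat n.+1 None) A).

Fixpoint close n : form n -> sentence :=
  if n is m.+1 then fun A => close (FAll A) else id.
Fixpoint closeN n : form n -> sentence :=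
  if n is m.+1 then fun A => closeN (FAllNat A) else id.

Section Realizability.
Variables (ap : papp) (s k : baire) (j : mmap).
Local Notation "x @@ y" := (lapp ap x y) (at level 40, left associativity).
Local Notation p0 := (proj0 ap s k).
Local Notation p1 := (proj1 ap s k).
Local Notation num := (numeral ap s k).

(* forall^+ d in X, Q d; false when X is undefined. *)
Definition forallp (X : option (set baire)) (Q : baire -> Prop) : Prop :=
  exists Y, [/\ X = Some Y, exists d, Y d & forall d, Y d -> Q d].

Definition defined (t : option baire) (Q : baire -> Prop) : Prop :=
  exists r, t = Some r /\ Q r.

(* The clauses recurse on the ranks of a and b, so the least solution is the
   only one. *)
Inductive realizes_eq : baire -> universe -> universe -> Prop :=
| req_nat e n : realizes_eq e (UNat n) (UNat n)
| req_set e a b :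
    is_uset a -> is_uset b ->
    forallp (j e) (fun d =>
      (forall p c, inpair p c a ->
         defined (p0 (Some d) @@ Some p) (fun r => realizes_mem r c b)) /\
      (forall p c, inpair p c b ->
         defined (p1 (Some d) @@ Some p) (fun r => realizes_mem r c a))) ->
    realizes_eq e a b
with realizes_mem : baire -> universe -> universe -> Prop :=
| rmem e a b :
    forallp (j e) (fun d =>
      exists c, defined (p0 (Some d)) (fun p => inpair p c b) /\
                defined (p1 (Some d)) (fun r => realizes_eq r a c)) ->
    realizes_mem e a b.

Fixpoint realizes n (A : form n) : (vars n -> universe) -> baire -> Prop :=
  match A in form n return (vars n -> universe) -> baire -> Prop with
  | FRel _ k R v => fun rho e =>
      exists xs : vars k -> nat,
        (forall i, rho (v i) = UNat (xs i)) /\ prel_holds R xs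
  | FNat _ x => fun rho e => exists n, rho x = UNat n /\ Some e = num n
  | FSet _ x => fun rho e => is_uset (rho x)
  | FMem _ x y => fun rho e => realizes_mem e (rho x) (rho y)
  | FEq _ x y => fun rho e => realizes_eq e (rho x) (rho y)
  | FAnd _ B C => fun rho e =>
      defined (p0 (Some e)) (realizes B rho) /\
      defined (p1 (Some e)) (realizes C rho)
  | FOr _ B C => fun rho e => forallp (j e) (fun d =>
      (p0 (Some d) = num 0 /\ defined (p1 (Some d)) (realizes B rho)) \/
      (p0 (Some d) = num 1 /\ defined (p1 (Some d)) (realizes C rho)))
  | FNot _ B => fun rho e => forall a, ~ realizes B rho a
  | FImp _ B C => fun rho e =>
      forall a, realizes B rho a -> defined (ap e a) (realizes C rho)
  | FAll n B => fun rho e => forallp (j e) (fun d =>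
      forall c, @realizes n.+1 B (scons c rho) d)
  | FEx n B => fun rho e => forallp (j e) (fun d =>
      exists c, @realizes n.+1 B (scons c rho) d)
  end.

End Realizability.

(* [s] and [k] are combinators of the relative pca P_j, from which its
   projections and numerals are formed. *)
Definition jrealizable (P : set baire) (ap : papp) (j : mmap) (s k : baire)
    (A : sentence) : Prop :=
  exists2 e, jpart P j e &
    realizes (japp ap j) s k j A (fun x : vars 0 => match x with end) e.

Fixpoint vshift k n : vars n -> vars (k + n) :=
  if k is l.+1 then fun x => Some (vshift l x) else id.
Fixpoint vleft k n : vars k -> vars (k + n) :=
  if k is l.+1 then omap (@vleft l n) else fun x => match x with end.
Arguments vshift k {n}.
Arguments vleft k n : clear implicits.

Fixpoint FImps n k : (vars k -> form n) -> form n -> form n :=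
  if k is l.+1 then fun h B => FImp (h None) (FImps (fun i => h (Some i)) B)
  else fun _ B => B.

Definition Graph n k (f : prf k) (xs : vars k -> vars n) (y : vars n) :
  form n := FRel (RGraph f) (scons y xs).
Definition IsZero n (y : vars n) : form n :=
  Graph PZero (fun i : vars 0 => match i with end) y.
Definition IsSucc n (x y : vars n) : form n := Graph PSucc (fun _ => x) y.

Local Notation "#0" := (None) (only parsing).
Local Notation "#1" := (Some None) (only parsing).
Local Notation "#2" := (Some (Some None)) (only parsing).
Local Notation "#3" := (Some (Some (Some None))) (only parsing).

(* IZF with the natural numbers as urelements, the primitive recursive
   relations being governed by their defining equations on N.  There is no
   axiom "everything is a number or a set".  In a schema, [form n.+i] is a formula
   with n further parameters, over which the axiom is universally closed. *)
Inductive IZF : sentence -> Prop :=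
| ax_refl : IZF (@close 1 (@FEq 1 #0 #0))
| ax_leibniz n (A : form n.+1) :
    IZF (@close n.+2 (FImp (@FEq n.+2 #1 #0)
       (FImp (@ren n.+1 n.+2 Some A) (@ren n.+1 n.+2 (omap Some) A))))
| ax_nat_set : IZF (@close 1 (FImp (@FNat 1 #0) (FNot (@FSet 1 #0))))
| ax_mem_set : IZF (@close 2 (FImp (@FMem 2 #1 #0) (@FSet 2 #0)))
| ax_graph_total k (f : prf k) :
    IZF (closeN (FEx (FAnd (@FNat k.+1 #0) (@Graph k.+1 k f Some #0))))
| ax_graph_uniq k (f : prf k) :
    IZF (@closeN k.+2 (FImp (FAnd
       (@Graph k.+2 k f (fun i => Some (Some i)) #1)
       (@Graph k.+2 k f (fun i => Some (Some i)) #0))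
       (@FEq k.+2 #1 #0)))
| ax_rel_graph k (f : prf k) :
    IZF (closeN (FIff (FRel (RZero f) id)
       (FEx (FAnd (@IsZero k.+1 #0) (@Graph k.+1 k f Some #0)))))
| ax_succ_neq0 :
    IZF (@closeN 2 (FImp (@IsSucc 2 #1 #0) (FNot (@IsZero 2 #0))))
| ax_succ_inj :
    IZF (@closeN 3 (FImp (FAnd (@IsSucc 3 #2 #0) (@IsSucc 3 #1 #0))
       (@FEq 3 #2 #1)))
| ax_proj k (i : vars k) : IZF (closeN (Graph (PProj i) id i))
| ax_comp n k (f : prf k) (g : vars k -> prf n) :
    IZF (@closeN (k + n).+1
      (FImps (fun i => @Graph (k + n).+1 n (g i)
                 (fun x => Some (vshift k x)) (Some (vleft k n i)))
      (FImp (@Graph (k + n).+1 k f (fun i => Some (vleft k n i)) #0)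
            (@Graph (k + n).+1 n (PComp f g)
                 (fun x => Some (vshift k x)) #0))))
| ax_rec0 n (f : prf n) (g : prf n.+2) :
    IZF (@closeN n.+2
      (FImp (FAnd (@IsZero n.+2 #1)
                  (@Graph n.+2 n f (fun x => Some (Some x)) #0))
            (@Graph n.+2 n.+1 (PRec f g) Some #0)))
| ax_recS n (f : prf n) (g : prf n.+2) :
    let par : vars n -> vars n.+4 := fun x => Some (Some (Some (Some x))) in
    IZF (@closeN n.+4
      (FImp (FAnd (@IsSucc n.+4 #3 #2)
            (FAnd (@Graph n.+4 n.+1 (PRec f g) (scons #3 par) #1)
                  (@Graph n.+4 n.+2 g
                     (@scons _ n.+1 #3 (scons #1 par)) #0)))
            (@Graph n.+4 n.+1 (PRec f g) (scons #2 par) #0)))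
| ax_nat_ind n (A : form n.+1) :
    IZF (close (FImp
      (FAnd (FAllNat (FImp (@IsZero n.+1 #0) A))
            (FAllNat (FAllNat (FImp (@IsSucc n.+2 #1 #0)
               (FImp (@ren n.+1 n.+2 Some A)
                     (@ren n.+1 n.+2 (omap Some) A))))))
      (FAllNat A)))
| ax_ext :
    IZF (FAllSet (FAllSet (FImp
      (FAll (FIff (@FMem 3 #0 #2) (@FMem 3 #0 #1)))
      (@FEq 2 #1 #0))))
| ax_pairing :
    IZF (FAll (FAll (FExSet (FAll
      (FIff (@FMem 4 #0 #1) (FOr (@FEq 4 #0 #3) (@FEq 4 #0 #2)))))))
| ax_union :
    IZF (FAllSet (FExSet (FAll
      (FIff (@FMem 3 #0 #1)
            (FEx (FAnd (@FMem 4 #0 #3) (@FMem 4 #1 #0)))))))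
| ax_powerset :
    IZF (FAllSet (FExSet (FAll
      (FIff (@FMem 3 #0 #1)
            (FAnd (@FSet 3 #0)
                  (FAll (FImp (@FMem 4 #0 #1) (@FMem 4 #0 #3))))))))
| ax_infinity :
    IZF (FExSet (FAll (FIff (@FMem 2 #0 #1) (@FNat 2 #0))))
| ax_set_ind n (A : form n.+1) :
    IZF (close (FImp
      (FAll (FImp
         (FAll (FImp (@FMem n.+2 #0 #1) (@ren n.+1 n.+2 (omap Some) A)))
         A))
      (FAll A)))
(* A may mention x = #0 and a = #1, but not b. *)
| ax_separation n (A : form n.+2) :
    IZF (close (FAllSet (FExSet (FAll
      (FIff (@FMem n.+3 #0 #1)
            (FAnd (@FMem n.+3 #0 #2)
                  (@ren n.+2 n.+3 (omap Some) A)))))))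
(* A may mention y = #0, x = #1 and a = #2, but not b. *)
| ax_collection n (A : form n.+3) :
    IZF (close (FAllSet (FImp
      (FAll (FImp (@FMem n.+2 #0 #1) (FEx A)))
      (FExSet (FAll (FImp (@FMem n.+3 #0 #2)
         (FEx (FAnd (@FMem n.+4 #0 #2)
                    (@ren n.+3 n.+4 (omap (omap Some)) A))))))))).

(* Main.v *)
Require Import Defs.
From mathcomp Require Import all_boot.
From mathcomp Require Import boolp classical_sets.

(** Over the pca P_j the jump j becomes a strong monad, with unit, functorial
    action and multiplication realized in P_j by iota, u and j_0.  Application
    in P_j evaluates singletons, so x can moreover be computed from e whenever
    j(e) = {x}.  Consequently every realizability predicate is uniformly closed
    under j, even N(a), which is not guarded by j, and McCarty's realizers for
    the axioms can be carried out under j.  Set induction is realized by a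
    fixed point, since realizable membership is well founded; collection uses
    choice in the metatheory. *)

Set Implicit Arguments.
Unset Strict Implicit.
Unset Printing Implicit Defensive.
Local Open Scope classical_set_scope.

(** * The jump as a monad *)

(** Three constraints shape the terms. An element of some j(e) cannot in general be taken out of it,
    so realizers work under [map] and [bind]; only where the goal is not visibly guarded by j does
    [stable] bring the result back. Application is strict and partial, so the definedness of every
    subterm is part of the proof; this matters most for equations between numbers, whose realizers
    are arbitrary. A quantifier over V needs one realizer for all sets: the terms never mention
    sets, and application is single-valued, so a separate check for each set suffices. The pca P and
    the laws of j enter only through the record [jump_monad]; all axioms are then realized from this
    record and the given combinators of P_j. *)

Lemma definedW t (R R' : baire -> Prop) :
  defined t R -> (forall r, R r -> R' r) -> defined t R'.
Proof. by move=> [r [-> Rr]] RR'; exists r; split=> //; apply: RR'. Qed.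

Lemma defined_eq t R : defined t R -> defined t (fun r => t = Some r /\ R r).
Proof. by move=> [r [-> Rr]]; exists r. Qed.

(** A partial value is unique, so the values obtained for the various [x] coincide; [x0] supplies
    definedness itself. This turns checks made for each set into one uniform realizer. *)
Lemma defined_forall T t (R : T -> baire -> Prop) (x0 : T) :
  (forall x, defined t (R x)) -> defined t (fun r => forall x, R x r).
Proof.
move=> tR; have [r [tE _]] := tR x0; exists r; split=> // x.
by have [r' [tr' Rr']] := tR x; move: tr'; rewrite tE => -[->].
Qed.

Lemma forallpW X (R R' : baire -> Prop) :
  forallp X R -> (forall d, R d -> R' d) -> forallp X R'.
Proof.
by move=> [Y [-> ne YR]] RR'; exists Y; split=> // d /YR; apply: RR'.
Qed.

Lemma forallp_ex X R : forallp X R -> exists d, R d.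
Proof. by move=> [Y [_ [d Yd] YR]]; exists d; apply: YR. Qed.

(* When j(e) is a singleton {x}, [lift] sends e to a constant function with
   value x. *)
Record jump_monad (Q : set baire) (ap : papp) (j : mmap)
    (ret map join lift : baire) : Prop := JumpMonad {
  ret_in : Q ret;
  map_in : Q map;
  join_in : Q join;
  lift_in : Q lift;
  jretP : forall x, defined (ap ret x) (fun r => forallp (j r) (eq x));
  jmapP : forall f e (R R' : baire -> Prop), forallp (j e) R ->
    (forall d, R d -> defined (ap f d) R') ->
    defined (ap map f) (fun m => defined (ap m e) (fun r => forallp (j r) R'));
  jjoinP : forall e R, forallp (j e) (fun d => forallp (j d) R) ->
    defined (ap join e) (fun r => forallp (j r) R);
  jliftP : forall e x, forallp (j e) (eq x) ->
    defined (ap lift e) (fun w => forall z, ap w z = Some x) }.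

Section JumpPca.
Variables (P : set baire) (ap : papp) (j : mmap).
Hypothesis hj : idempotent_jump P ap j.

Lemma jeltP a y : j a = Some [set y] -> jelt j a = Some y.
Proof.
move=> ja; rewrite /jelt; case: pselect => [h|]; last by case; exists y.
case: cid => z /=; rewrite ja => -[yz]; congr Some.
have : [set y] z by rewrite yz.
by move=> /= ->.
Qed.

Lemma jelt_Some a y : jelt j a = Some y -> j a = Some [set y].
Proof.
by rewrite /jelt; case: pselect => // h [<-]; case: cid.
Qed.

Lemma forallp_jelt a y : forallp (j a) (eq y) -> jelt j a = Some y.
Proof.
move=> [Y [jaY [d Yd] Yy]]; apply: jeltP; rewrite jaY; congr Some.
apply/seteqP; split=> z /=; first by move/Yy => <-.
by move=> ->; rewrite (Yy _ Yd).
Qed.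

Lemma mscaleE a x Y : j x = Some Y -> (forall y, Y y -> ap a y <> None) ->
  mscale ap a j x = Some [set z | exists2 y, Y y & ap a y = Some z].
Proof.
move=> jx aY; rewrite /mscale /mcomp jx; case: asboolP => [_|]; last first.
  by case=> y /aY /=; rewrite /mdom /=; case: (ap a y).
congr Some; apply/seteqP; split=> z /=.
- move=> [y Yy [Z]]; case E: (ap a y) => [w|] //= [<-] /= ->; by exists y.
- by move=> [y Yy E]; exists y => //; exists [set z]; rewrite ?E.
Qed.

Hypothesis hP : relative_pca P ap.

(** Iota is used twice: r = iota x satisfies j(r) = {x}, hence acts in P_j as x acts in P, and r
    lies in P_j because it is the element of j(iota r). *)
Lemma pca_jpart_code x : P x ->
  exists2 c, jpart P j c & forall y, japp ap j c y = ap x y.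
Proof.
move=> Px; have [s0 [k0 C]] := hP; case: hj => _ [i Pi iP] _.
have iE y : exists2 r, ap i y = Some r & j r = Some [set y].
  by move: (iP y); case: (ap i y) => [r|] //= ->; exists r.
have [r ixr jr] := iE x; have Pr : P r by apply: (comb_closed C _ _ ixr).
have [r' irr' jr'] := iE r; have Pr' : P r' by apply: (comb_closed C _ _ irr').
exists r; first by exists r' => //; apply: jeltP.
by move=> y; rewrite /japp (jeltP jr).
Qed.

(** The four elements are codes for iota, u u, j_0 and u k. For [map], one u deals with the jump on
    the function: j((u u) f) = u j(f) = {u f'}, so the result acts as u f', and the second u maps f'
    over j(e). For [lift], j((u k) e) = k j(e) = {k x}, which acts as the constant function x. *)
Lemma jump_monad_jpart :
  exists ret map join lift,
    jump_monad (jpart P j) (japp ap j) j ret map join lift.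
Proof.
have [s0 [k0 C]] := hP; case: (hj) => [[u Pu uP] [i Pi iP] [j0 Pj0 j0P]].
have iE y : exists2 r, ap i y = Some r & j r = Some [set y].
  by move: (iP y); case: (ap i y) => [r|] //= ->; exists r.
have uE a x Y : j x = Some Y -> (forall y, Y y -> ap a y <> None) ->
    exists g r, [/\ ap u a = Some g, ap g x = Some r &
      j r = Some [set z | exists2 y, Y y & ap a y = Some z]].
  move=> jx aY; move: (uP a x); rewrite (mscaleE jx aY).
  case: (ap u a) => [g|] //=; case gx: (ap g x) => [r|] //= jr.
  by exists g, r; split=> //; rewrite -jr.
(* The law for u speaks of u a x as a whole. Testing it at x = iota y, whose jump is {y}, shows that
   u a alone is defined. *)
have u1 a y z : ap a y = Some z -> exists g, ap u a = Some g.
  move=> az; have [r _ jr] := iE y.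
  have [||g [r' [? _ _]]] := uE a r [set y] => //; last by exists g.
  by move=> _ ->; rewrite az.
have [kk kkE] : exists kk, ap k0 k0 = Some kk.
  by move: (comb_k C k0 k0); case: (ap k0 k0) => [kk|] //= _; exists kk.
have [uk ukE] := u1 _ _ _ kkE; have [uu uuE] := u1 _ _ _ ukE.
have Puk : P uk by apply: (comb_closed C _ _ ukE) => //; apply: comb_k_in C.
have Puu : P uu by apply: (comb_closed C _ _ uuE).
have [ret Qret retE] := pca_jpart_code Pi.
have [join Qjoin joinE] := pca_jpart_code Pj0.
have [map Qmap mapE] := pca_jpart_code Puu.
have [lift Qlift liftE] := pca_jpart_code Puk.
exists ret, map, join, lift; split=> //.
- move=> x; rewrite retE; have [r -> jr] := iE x; exists r; split=> //.
  by exists [set x]; split=> //; exists x.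
- move=> f e R R' [Y [je [d0 Yd0] YR]] RR'.
  (* Since j(e) is nonempty, [f] is applied in P_j to at least one element, and the definedness of
     that application already makes j(f) a singleton. *)
  have [r0 [+ _]] := RR' _ (YR _ Yd0); rewrite /japp.
  case fE: (jelt j f) => [f'|] //= _.
  have fR d : Y d -> defined (ap f' d) R'.
    by move/YR/RR'; rewrite /japp fE.
  have [|g [r [ufg ger jr]]] := uE f' e Y je.
    by move=> d /fR [r [-> _]].
  have [||g' [m [uug' ufm jm]]] := uE u f [set f'].
  + exact: jelt_Some.
  + by move=> _ ->; rewrite ufg.
  move: uug'; rewrite uuE => -[guu]; rewrite -{}guu {g'} in ufm.
  have {}jm : jelt j m = Some g.
    apply: jeltP; rewrite jm; congr Some; apply/seteqP; split=> z /=.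
      by move=> [_ ->]; rewrite ufg => -[].
    by move=> ->; exists f'.
  exists m; split; first by rewrite -/(japp ap j map f) mapE.
  exists r; rewrite jm /= ger; split=> //.
  exists [set z | exists2 y, Y y & ap f' y = Some z]; split=> //.
    by have [z [E _]] := fR _ Yd0; exists z, d0.
  by move=> z [y /fR [w [-> Rw]] [<-]].
- move=> e R [Y [je [d0 Yd0] YR]]; rewrite joinE.
  move: (j0P e); rewrite /mcomp je; case: asboolP; last first.
    by case=> y /YR [Z [E _ _]]; rewrite /mdom /= E.
  move=> _; case: (ap j0 e) => [r|] //= jr; exists r; split=> //.
  rewrite -jr; eexists; split; first by [].
    have [Z [E [z Zz] _]] := YR _ Yd0; exists z => /=; exists d0 => //.
    by exists Z.
  move=> z /= [y /YR [Z [-> _ ZR]]] [Z' [<-]]; exact: ZR.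
- move=> e x ex; rewrite liftE.
  have jex := jelt_Some (forallp_jelt ex).
  have [kx kxE] : exists kx, ap k0 x = Some kx.
    by move: (comb_k C x x); case: (ap k0 x) => [kx|] //= _; exists kx.
  have [|g [r [ukg ger jr]]] := uE k0 e _ jex.
    by move=> _ ->; rewrite kxE.
  move: ukg; rewrite ukE => -[gE]; rewrite -gE in ger; rewrite ger.
  exists r; split=> // z; rewrite /japp (@jeltP _ kx) /=; last first.
    rewrite jr; congr Some; apply/seteqP; split=> w /=.
      by move=> [_ ->]; rewrite kxE => -[].
    by move=> ->; exists x.
  by move: (comb_k C x z); rewrite kxE.
Qed.

End JumpPca.

(** * Bracket abstraction *)

Inductive poly :=
| PV of nat
| PC of baire
| PA of poly & poly.

Notation "t @@ u" := (PA t u) (at level 40, left associativity).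
Notation "$ i" := (PV i) (at level 8, i at level 0, format "$ i").

Fixpoint poly_in (Q : set baire) (t : poly) : Prop :=
  match t with
  | PV _ => True
  | PC c => Q c
  | PA t u => poly_in Q t /\ poly_in Q u
  end.

Definition pcons (x : baire) (rho : nat -> baire) (n : nat) : baire :=
  if n is m.+1 then rho m else x.

Section Calculus.
Variables (Q : set baire) (ap : papp) (s k : baire).
Hypothesis C : combinators Q ap s k.

Fixpoint peval (rho : nat -> baire) (t : poly) : option baire :=
  match t with
  | PV i => Some (rho i)
  | PC c => Some c
  | PA t u => lapp ap (peval rho t) (peval rho u)
  end.

(* Bracket abstraction of the variable $0; a value for every body, because
   [s a b] is always defined. *)
Fixpoint lam (t : poly) : poly :=
  match t with
  | PV 0 => PC s @@ PC k @@ PC k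
  | PV i.+1 => PC k @@ $i
  | PC c => PC k @@ PC c
  | PA t u => PC s @@ lam t @@ lam u
  end.

Definition pI : poly := PC s @@ PC k @@ PC k.
Definition ppair (t u : poly) : poly :=
  PC s @@ (PC s @@ pI @@ (PC k @@ t)) @@ (PC k @@ u).
Definition ppr0 (t : poly) : poly := PC s @@ pI @@ (PC k @@ PC k) @@ t.
Definition ppr1 (t : poly) : poly := PC s @@ pI @@ (PC k @@ (PC k @@ pI)) @@ t.

Local Notation p0 := (proj0 ap s k).
Local Notation p1 := (proj1 ap s k).

(** A weakest precondition for total correctness. Postconditions are pushed backwards through a
    term, so that values of subterms appear only through their specifications. *)
Definition wp (rho : nat -> baire) (t : poly) (R : baire -> Prop) : Prop :=
  defined (peval rho t) R.

Lemma kP a : defined (ap k a) (fun g => forall b, ap g b = Some a).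
Proof.
have := comb_k C a; case: (ap k a) => [g|] H; first by exists g.
by have := H a.
Qed.

Lemma sP a b : defined (ap s a) (fun g => defined (ap g b) (fun h =>
  forall c d, lapp ap (ap a c) (ap b c) = Some d -> ap h c = Some d)).
Proof.
have := @comb_s_def _ _ _ _ C a b; have := @comb_s _ _ _ _ C a b.
case: (ap s a) => [g|] //=; rewrite /lapp /=.
case gb : (ap g b) => [h|] //= H _; exists g; split=> //.
by exists h; split=> //.
Qed.

Lemma cIP : defined (cI ap s k) (fun i => forall x, ap i x = Some x).
Proof.
have [g [sk [h [gk H]]]] := sP k k; exists h.
split; first by rewrite /cI /lapp /= sk /= gk.
move=> x; apply: H.
by have [y [-> yx]] := kP x; rewrite /lapp /= yx.
Qed.

Lemma wp_var rho i R : R (rho i) -> wp rho $i R.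
Proof. by exists (rho i). Qed.

Lemma wp_cst rho c R : R c -> wp rho (PC c) R.
Proof. by exists c. Qed.

(* The argument comes first, so that a curried application is handled only once
   all its arguments are values. *)
Lemma wp_app rho t u R :
  wp rho u (fun x => wp rho t (fun f => defined (ap f x) R)) ->
  wp rho (t @@ u) R.
Proof.
by move=> [x [E [f [F H]]]]; rewrite /wp /= E F.
Qed.

(** The law for [s] is one-sided, so nothing can be said about an application whose body is
    undefined. The induction on [t] therefore concerns only bodies that have a value, and the
    postcondition form follows. *)
Lemma wp_lam rho t R :
  (forall f, (forall x T, wp (pcons x rho) t T -> defined (ap f x) T) -> R f) ->
  wp rho (lam t) R.
Proof.
move=> RH; suff: wp rho (lam t)
    (fun f => forall x v, peval (pcons x rho) t = Some v -> ap f x = Some v).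
  move=> /definedW; apply=> f Hf; apply: RH => x T [v [/Hf -> Tv]].
  by exists v.
elim: t {R RH} => [[|i]|c|t IHt u IHu] /=.
- by apply: definedW cIP _ => f Hf x v [<-]; apply: Hf.
- apply: wp_app; apply: wp_var; apply: wp_cst.
  by apply: definedW (kP _) _ => f Hf x v [<-].
- apply: wp_app; apply: wp_cst; apply: wp_cst.
  by apply: definedW (kP _) _ => f Hf x v [<-].
- apply: wp_app; apply: definedW IHu _ => b Hb.
  apply: wp_app; apply: definedW IHt _ => a Ha; apply: wp_cst.
  apply: definedW (sP a b) _ => g /definedW; apply=> h Hh x v tu; apply: Hh.
  move: tu; case E: (peval _ t) => [y|] //; case F: (peval _ u) => [z|] //=.
  by rewrite (Ha _ _ E) (Hb _ _ F).
Qed.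

(** The projection is the term s i (k k), which sends d to i d (k k d) = d k. *)
Lemma proj0E d x : ap d k = Some x -> p0 (Some d) = Some x.
Proof.
move=> dx; have [i [iE iP]] := cIP; have [kk [kkE kkP]] := kP k.
have [g [si [h [gk H]]]] := sP i kk.
rewrite /proj0 iE /lapp /= si /= kkE /= gk /=; apply: H.
by rewrite iP kkP.
Qed.

Lemma proj1E d x : defined (cKI ap s k) (fun ki => ap d ki = Some x) ->
  p1 (Some d) = Some x.
Proof.
move=> [ki [kiE dx]]; have [i [iE iP]] := cIP.
have [kk [kkE kkP]] := kP ki.
have [g [si [h [gk H]]]] := sP i kk.
rewrite /proj1 kiE iE /lapp /= si /= kkE /= gk /=; apply: H.
by rewrite iP kkP.
Qed.

Lemma cKIP : defined (cKI ap s k)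
  (fun ki => forall x, defined (ap ki x) (fun g => forall y, ap g y = Some y)).
Proof.
have [i [iE iP]] := cIP; have [ki [kiE kiP]] := kP i.
exists ki; rewrite /cKI iE; split=> // x; exists i; rewrite kiP; split=> //.
Qed.

Lemma cpairP x y : defined (cpair ap s k (Some x) (Some y))
  (fun p => p0 (Some p) = Some x /\ p1 (Some p) = Some y).
Proof.
have [i [iE iP]] := cIP; have [kx [kxE kxP]] := kP x.
have [ky [kyE kyP]] := kP y.
have [g [si [h [gx Hh]]]] := sP i kx.
have [g' [sh [p [gy Hp]]]] := sP h ky.
exists p; split.
  by rewrite /cpair iE /lapp /= si /= kxE /= gx /= sh /= kyE.
split.
- apply: proj0E; apply: Hp.
  have [z [kz zP]] := kP x.
  by rewrite (Hh _ z) ?kyP /lapp /= ?zP // iP kxP /lapp.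
- apply: proj1E; have [ki [kiE kiP]] := cKIP; exists ki; split=> //.
  have [z [kz zP]] := kiP x.
  by apply: Hp; rewrite (Hh _ z) ?kyP /lapp /= ?zP // iP kxP /lapp.
Qed.

Lemma wp_pair rho t u R :
  wp rho u (fun y => wp rho t (fun x => forall p,
    p0 (Some p) = Some x -> p1 (Some p) = Some y -> R p)) ->
  wp rho (ppair t u) R.
Proof.
move=> [y [uy [x [tx H]]]]; have [p [pE [p0x p1y]]] := cpairP x y.
exists p; split; last exact: H.
by move: pE; rewrite -tx -uy.
Qed.

Lemma wp_pr0 rho t R :
  wp rho t (fun d => defined (p0 (Some d)) R) -> wp rho (ppr0 t) R.
Proof. by move=> [d [td]]; rewrite -td. Qed.

Lemma wp_pr1 rho t R :
  wp rho t (fun d => defined (p1 (Some d)) R) -> wp rho (ppr1 t) R.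
Proof. by move=> [d [td]]; rewrite -td. Qed.

Lemma poly_in_lam t : poly_in Q t -> poly_in Q (lam t).
Proof.
have Qs := comb_s_in C; have Qk := comb_k_in C.
by elim: t => [[|i]|c|t IHt u IHu] //= [/IHt ? /IHu].
Qed.

Lemma poly_in_pair t u : poly_in Q t -> poly_in Q u -> poly_in Q (ppair t u).
Proof. by have Qs := comb_s_in C; have Qk := comb_k_in C. Qed.

Lemma poly_in_pr0 t : poly_in Q t -> poly_in Q (ppr0 t).
Proof. by have Qs := comb_s_in C; have Qk := comb_k_in C. Qed.

Lemma poly_in_pr1 t : poly_in Q t -> poly_in Q (ppr1 t).
Proof. by have Qs := comb_s_in C; have Qk := comb_k_in C. Qed.

(** Evaluating every free variable to [k], an element of [Q], spares a closedness condition on [t]: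
    the value is an iterated application of elements of [Q]. *)
Lemma poly_realizer t R : poly_in Q t -> wp (fun=> k) t R ->
  exists2 e, Q e & R e.
Proof.
move=> Qt [r [tE Rr]]; exists r => //; elim: t r Qt tE {Rr} => /=.
- by move=> _ r _ [<-]; apply: comb_k_in C.
- by move=> c r Qc [<-].
- move=> t IHt u IHu r [/IHt {}IHt /IHu {}IHu].
  case tf: (peval _ t) => [f|] //; case ux: (peval _ u) => [x|] //= fx.
  by apply: (comb_closed C _ _ fx); [apply: IHt|apply: IHu].
Qed.

End Calculus.
Arguments lam : simpl never.
Arguments ppair : simpl never.
Arguments ppr0 : simpl never.
Arguments ppr1 : simpl never.

Ltac wpsimpl := cbv beta iota delta [pcons].
Ltac wp_steps C := repeat (lazymatch goal with
  | |- wp _ _ (ppair _ _ _ _) _ => apply: (wp_pair C)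
  | |- wp _ _ (ppr0 _ _ _) _ => apply: wp_pr0
  | |- wp _ _ (ppr1 _ _ _) _ => apply: wp_pr1
  | |- wp _ _ (PA _ _) _ => apply: wp_app
  | |- wp _ _ (PV _) _ => apply: wp_var; wpsimpl
  | |- wp _ _ (PC _) _ => apply: wp_cst
  end).
Create HintDb inQ.
Ltac poly_in_tac C := repeat (lazymatch goal with
  | |- poly_in _ (lam _ _ _) => apply: (poly_in_lam C)
  | |- poly_in _ (ppair _ _ _ _) => apply: (poly_in_pair C)
  | |- poly_in _ (ppr0 _ _ _) => apply: (poly_in_pr0 C)
  | |- poly_in _ (ppr1 _ _ _) => apply: (poly_in_pr1 C)
  | |- poly_in _ (PA _ _) => split
  | |- poly_in _ (PV _) => exact I
  | |- poly_in _ (PC _) => simpl; solve [assumption | eauto with inQ]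
  end).

(** * Realizers in a pca with a jump monad *)

Section Algebra.
Variables (Q : set baire) (ap : papp) (j : mmap) (s k : baire).
Variables (ret map join lift : baire).
Hypothesis C : combinators Q ap s k.
Hypothesis M : jump_monad Q ap j ret map join lift.

Local Notation lam := (lam s k).
Local Notation ppair := (ppair s k).
Local Notation ppr0 := (ppr0 s k).
Local Notation ppr1 := (ppr1 s k).
Local Notation p0 := (proj0 ap s k).
Local Notation p1 := (proj1 ap s k).
Local Notation num := (numeral ap s k).
Local Notation req := (realizes_eq ap s k j).
Local Notation rmem := (realizes_mem ap s k j).

Let k_in := comb_k_in C.
Let s_in := comb_s_in C.
Let rt_in := ret_in M.
Let mp_in := map_in M.
Let jn_in := join_in M.
Let lf_in := lift_in M.
Local Hint Resolve k_in s_in rt_in mp_in jn_in lf_in : inQ.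

Ltac wps := wp_steps C.
Ltac inQ := poly_in_tac C.

Lemma proj0_defined d x (R : baire -> Prop) :
  p0 (Some d) = Some x -> R x -> defined (p0 (Some d)) R.
Proof. by exists x. Qed.

Lemma proj1_defined d x (R : baire -> Prop) :
  p1 (Some d) = Some x -> R x -> defined (p1 (Some d)) R.
Proof. by exists x. Qed.

Lemma ret_spec x (T : baire -> Prop) :
  (forall r, forallp (j r) (eq x) -> T r) -> defined (ap ret x) T.
Proof. by move=> H; apply: definedW (jretP M x) H. Qed.

Lemma map_spec f e (R R' T : baire -> Prop) : forallp (j e) R ->
  (forall d, R d -> defined (ap f d) R') ->
  (forall r, forallp (j r) R' -> T r) ->
  defined (ap map f) (fun m => defined (ap m e) T).
Proof.
move=> eR fR H; apply: definedW (jmapP M eR fR) _ => m /definedW; apply;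
  exact: H.
Qed.

(** * Binding, evaluation of singletons, and fixed points *)

Lemma bind_exists : exists2 b, Q b & forall f e (R R' T : baire -> Prop),
  forallp (j e) R ->
  (forall d, R d -> defined (ap f d) (fun r => forallp (j r) R')) ->
  (forall r, forallp (j r) R' -> T r) ->
  defined (ap b f) (fun m => defined (ap m e) T).
Proof.
apply: (poly_realizer C (t := lam (lam (PC join @@ (PC map @@ $1 @@ $0))))).
  by inQ.
apply: (wp_lam C) => b bP f e R R' T eR fR H; apply: bP.
apply: (wp_lam C) => g gP; apply: gP; wps.
apply: map_spec eR fR _ => r rR'; wps; apply: definedW (jjoinP M rR') H.
Qed.
(** The realizer is chosen from its existence statement, so later proofs use its specification and
    never the term. All combinators below are packaged in this way. *)
Definition bind := s2val (cid2 bind_exists).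
Lemma bind_in : Q bind.
Proof. exact: s2valP (cid2 bind_exists). Qed.
Definition bind_spec := s2valP' (cid2 bind_exists).
Local Hint Resolve bind_in : inQ.

(** Here [lift e] is constantly x; applying it to any argument at all, for instance [e], brings x
    out of the jump. *)
Lemma ext_exists : exists2 b, Q b & forall e x (T : baire -> Prop),
  forallp (j e) (eq x) -> T x -> defined (ap b e) T.
Proof.
apply: (poly_realizer C (t := lam (PC lift @@ $0 @@ $0))); first by inQ.
apply: (wp_lam C) => b bP e x T ex Tx; apply: bP; wps.
by apply: definedW (jliftP M ex) _ => w ->; exists x.
Qed.
Definition ext := s2val (cid2 ext_exists).
Lemma ext_in : Q ext.
Proof. exact: s2valP (cid2 ext_exists). Qed.
Definition ext_spec := s2valP' (cid2 ext_exists).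
Local Hint Resolve ext_in : inQ.

(* g = w w with w = \w x. f (w w) x. *)
Lemma fix_exists : exists2 b, Q b & forall f, defined (ap b f) (fun g =>
  forall x R, defined (ap f g) (fun h => defined (ap h x) R) ->
  defined (ap g x) R).
Proof.
pose w := lam (lam ($2 @@ ($1 @@ $1) @@ $0)).
apply: (poly_realizer C (t := lam (PA (lam ($0 @@ $0)) w))); first by inQ.
apply: (wp_lam C) => b bP f; apply: bP; wps; apply: (wp_lam C) => w' wP; wps.
apply: (wp_lam C) => h hP; apply: hP; wps.
(* [defined_eq] retains the equation between [g] and the self-application, so that the
   self-application inside the body is recognized as the same [g]. *)
have /defined_eq : defined (ap w' w') (fun g => forall x R,
    wp ap (pcons x (pcons w' (pcons f (fun=> k)))) ($2 @@ ($1 @@ $1) @@ $0) R ->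
    defined (ap g x) R).
  by apply: wP; apply: (wp_lam C) => g gP.
move=> /definedW; apply=> g [wg gP] x R fR; apply: gP; wps.
by exists g; split=> //; wps.
Qed.
Definition fixc := s2val (cid2 fix_exists).
Lemma fixc_in : Q fixc.
Proof. exact: s2valP (cid2 fix_exists). Qed.
Definition fixc_spec := s2valP' (cid2 fix_exists).
Local Hint Resolve fixc_in : inQ.

(** * Equality and membership *)

Lemma memE e a b : rmem e a b <-> forallp (j e) (fun d =>
  exists c, defined (p0 (Some d)) (fun p => inpair p c b) /\
            defined (p1 (Some d)) (fun r => req r a c)).
Proof. by split=> [[]|] // ?; constructor. Qed.

Lemma eqE e a b : is_uset a -> is_uset b -> req e a b <->
  forallp (j e) (fun d =>
    (forall p c, inpair p c a ->
      defined (lapp ap (p0 (Some d)) (Some p)) (fun r => rmem r c b)) /\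
    (forall p c, inpair p c b ->
      defined (lapp ap (p1 (Some d)) (Some p)) (fun r => rmem r c a))).
Proof.
move=> sa sb; split; last by move=> H; apply: req_set.
by move=> H; case: H sa sb.
Qed.

Lemma req_nat_l e n b : req e (UNat n) b -> b = UNat n.
Proof.
by move E: (UNat n) => a H; case: H E => // e' a' b' + _ _ E; rewrite -E.
Qed.

Lemma req_nat_r e n a : req e a (UNat n) -> a = UNat n.
Proof.
by move E: (UNat n) => b H; case: H E => // e' a' b' _ + _ E; rewrite -E.
Qed.

Lemma req_uset e a b : req e a b -> is_uset a <-> is_uset b.
Proof. by case. Qed.

Lemma inpair_uset p c b : inpair p c b -> is_uset b.
Proof. by case: b. Qed.

Lemma rmem_uset e a b : rmem e a b -> is_uset b.
Proof.
by move/memE/forallp_ex => [d [c [[p [_ pb]] _]]]; apply: inpair_uset pb.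
Qed.

(** Each d in j(e) yields a realizer of membership. As membership is itself guarded by j, [bind]
    merges the two layers into one. *)
Lemma eq_forward_exists : exists2 b, Q b & forall e p a a' c, req e a a' ->
  inpair p c a ->
  defined (ap b e) (fun g => defined (ap g p) (fun r => rmem r c a')).
Proof.
apply: (poly_realizer C
  (t := lam (lam (PC bind @@ lam (ppr0 $0 @@ $1) @@ $1)))); first by inQ.
apply: (wp_lam C) => b bP e p a a' c eq ac; apply: bP;
  apply: (wp_lam C) => g gP; apply: gP.
wps; apply: (wp_lam C) => f fP; wps.
have sa := inpair_uset ac; have sa' := (req_uset eq).1 sa.
move/(eqE _ sa sa') : eq => eq.
apply: (bind_spec eq) => [d [/(_ _ _ ac) [r [+ rm]] _]|r rm]; last first.
  by apply/memE; exact: rm.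
case pd: (p0 (Some d)) => [x|] //= xp.
apply: fP; wps; apply: proj0_defined pd _; exists r; split=> //.
by apply/memE.
Qed.

Definition eq_forward := s2val (cid2 eq_forward_exists).
Lemma eq_forward_in : Q eq_forward.
Proof. exact: s2valP (cid2 eq_forward_exists). Qed.
Definition eq_forward_spec := s2valP' (cid2 eq_forward_exists).
Local Hint Resolve eq_forward_in : inQ.

Lemma eq_backward_exists : exists2 b, Q b & forall e p a a' c, req e a a' ->
  inpair p c a' ->
  defined (ap b e) (fun g => defined (ap g p) (fun r => rmem r c a)).
Proof.
apply: (poly_realizer C
  (t := lam (lam (PC bind @@ lam (ppr1 $0 @@ $1) @@ $1)))); first by inQ.
apply: (wp_lam C) => b bP e p a a' c eq ac; apply: bP;
  apply: (wp_lam C) => g gP; apply: gP.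
wps; apply: (wp_lam C) => f fP; wps.
have sa' := inpair_uset ac; have sa := (req_uset eq).2 sa'.
move/(eqE _ sa sa') : eq => eq.
apply: (bind_spec eq) => [d [_ /(_ _ _ ac) [r [+ rm]]]|r rm]; last first.
  by apply/memE; exact: rm.
case pd: (p1 (Some d)) => [x|] //= xp.
apply: fP; wps; apply: proj1_defined pd _; exists r; split=> //.
by apply/memE.
Qed.
Definition eq_backward := s2val (cid2 eq_backward_exists).
Lemma eq_backward_in : Q eq_backward.
Proof. exact: s2valP (cid2 eq_backward_exists). Qed.
Definition eq_backward_spec := s2valP' (cid2 eq_backward_exists).
Local Hint Resolve eq_backward_in : inQ.

Lemma req_intro r p f g a b : forallp (j r) (eq p) ->
  p0 (Some p) = Some f -> p1 (Some p) = Some g -> is_uset a -> is_uset b ->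
  (forall q c, inpair q c a -> defined (ap f q) (fun r => rmem r c b)) ->
  (forall q c, inpair q c b -> defined (ap g q) (fun r => rmem r c a)) ->
  req r a b.
Proof.
move=> jr pf pg sa sb fP gP; apply/(eqE _ sa sb); apply: forallpW jr _.
by move=> _ <-; rewrite pf pg.
Qed.

Lemma rmem_intro r p q e a b c : forallp (j r) (eq p) ->
  p0 (Some p) = Some q -> p1 (Some p) = Some e -> inpair q c b -> req e a c ->
  rmem r a b.
Proof.
move=> jr pq pe qc ec; apply/memE; apply: forallpW jr _ => _ <-.
by exists c; split; [exists q|exists e].
Qed.

(* The realizers of an equation between sets are produced as pairs of closures
   under [ret], so that they are defined even when the input is a realizer of
   an equation between numbers, about which nothing is known. *)
Lemma req_refl_exists : exists2 e, Q e & forall a, req e a a.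
Proof.
pose m := lam (PC ret @@ ppair $0 ($2 @@ $0)).
apply: (poly_realizer C (t := PC fixc @@
  lam (lam (PC ret @@ ppair m m)) @@ PC k)); first by inQ.
wps; apply: (wp_lam C) => F FP; wps; apply: definedW (fixc_spec F) _ => G GP.
apply: (defined_forall (UNat 0)) => a.
(* The argument of the fixed point is a dummy: [k] at the top, a tag in the recursive calls. The
   induction has to cover all arguments. *)
suff: forall x, defined (ap G x) (fun r => req r a a) by apply.
elim: a => [n|X p c IH] x; apply: GP; apply: FP; apply: (wp_lam C) => h hP.
  apply: hP; wps; apply: (wp_lam C) => f fP; apply: (wp_lam C) => g gP q _ _;
    wps.
  by apply: ret_spec => r _; constructor.
apply: hP; wps; apply: (wp_lam C) => f fP; apply: (wp_lam C) => g gP q qg qf;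
  wps.
apply: ret_spec => r jr; apply: (req_intro jr qg qf) => // p' _ [i [<- <-]].
- apply: gP; wps; apply: definedW (IH i _) _ => e ec; wps => v v0 v1; wps.
  by apply: ret_spec => r' jr'; apply: (rmem_intro jr' v0 v1 _ ec); exists i.
- apply: fP; wps; apply: definedW (IH i _) _ => e ec; wps => v v0 v1; wps.
  by apply: ret_spec => r' jr'; apply: (rmem_intro jr' v0 v1 _ ec); exists i.
Qed.
Definition req_refl := s2val (cid2 req_refl_exists).
Lemma req_refl_in : Q req_refl.
Proof. exact: s2valP (cid2 req_refl_exists). Qed.
Definition req_refl_spec := s2valP' (cid2 req_refl_exists).
Local Hint Resolve req_refl_in : inQ.

(** Symmetry exchanges the two transport maps. The result is fixed before the sets are chosen, so
    during substitution one inverted realizer serves several variables at once. *)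
Lemma req_sym_exists : exists2 b, Q b & forall e, defined (ap b e) (fun r =>
  forall a a', req e a a' -> req r a' a).
Proof.
apply: (poly_realizer C (t := lam (PC ret @@
  ppair (lam (PC eq_backward @@ $1 @@ $0)) (lam (PC eq_forward @@ $1 @@
    $0))))); first by inQ.
apply: (wp_lam C) => b bP e; apply: bP; wps.
apply: (wp_lam C) => g gP; apply: (wp_lam C) => f fP q qf qg; wps.
apply: ret_spec => r jr a a' E; have [ua ua'] := req_uset E.
case: a => [n|X p c] in E ua ua' *.
  by rewrite (req_nat_l E); constructor.
apply: (req_intro jr qf qg) => // [|p' c' a'c|p' c' ac]; first exact: ua.
- by apply: fP; wps; apply: eq_backward_spec E a'c.
- by apply: gP; wps; apply: eq_forward_spec E ac.
Qed.
Definition req_sym := s2val (cid2 req_sym_exists).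
Lemma req_sym_in : Q req_sym.
Proof. exact: s2valP (cid2 req_sym_exists). Qed.
Definition req_sym_spec := s2valP' (cid2 req_sym_exists).
Local Hint Resolve req_sym_in : inQ.

Lemma defined2W f x y (R R' : baire -> Prop) :
  defined (ap f x) (fun g => defined (ap g y) R) ->
  (forall r, R r -> R' r) ->
  defined (ap f x) (fun g => defined (ap g y) R').
Proof. by move=> /definedW H RR'; apply: H => g /definedW; apply. Qed.

Lemma defined2_forall T f x y (R : T -> baire -> Prop) (z0 : T) :
  (forall z, defined (ap f x) (fun g => defined (ap g y) (R z))) ->
  defined (ap f x) (fun g => defined (ap g y) (fun r => forall z, R z r)).
Proof.
move=> H; have [g [fg _]] := H z0; exists g; split=> //.
apply: (defined_forall z0) => z; have [g' [fg' gR]] := H z.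
by move: fg'; rewrite fg => -[->].
Qed.

(** The common step x = y, y in a, y = z, z in c. Transitivity enters as a parameter [t], required
    only for middle terms y from [a]: in the proof of transitivity it is the fixed point under
    construction, known only by induction for such y. *)
Lemma mem_chain_exists : exists2 b, Q b & forall t m f x a c, rmem m x a ->
  (forall q y, inpair q y a -> defined (ap f q) (fun r => rmem r y c)) ->
  (forall q y e e' z, inpair q y a -> req e x y -> req e' y z ->
    defined (ap t e) (fun g => defined (ap g e') (fun r => req r x z))) ->
  defined (ap b t) (fun g => defined (ap g m) (fun h => defined (ap h f)
    (fun r => rmem r x c))).
Proof.
apply: (poly_realizer C (t := lam (lam (lam (PC bind @@
  (lam (PC map @@ (lam (ppair (ppr0 $0) ($4 @@ ppr1 $1 @@ ppr1 $0)))
    @@ ($1 @@ ppr0 $0))) @@ $1))))); first by inQ.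
apply: (wp_lam C) => b bP t m f x a c /memE xa fP tP; apply: bP;
  apply: (wp_lam C) => g gP.
apply: gP; apply: (wp_lam C) => h hP; apply: hP; wps;
  apply: (wp_lam C) => b' b'P; wps.
apply: (bind_spec xa) => [d [y [[q [dq qy]] [e [de ey]]]]|r rm]; last first.
  by apply/memE; exact: rm.
apply: b'P; wps; apply: proj0_defined dq _; wps.
apply: definedW (fP _ _ qy) _ => r /memE rm; wps;
  apply: (wp_lam C) => b'' b''P; wps.
apply: (map_spec rm) => [d' [z [[q' [dq' qz]] [e' [de' ez]]]]|r' rm'];
  last exact: rm'.
apply: b''P; wps; apply: proj1_defined de' _; wps.
apply: proj1_defined de _; wps; apply: defined2W (tP _ _ _ _ _ qy ey ez) _.
move=> e'' e''P; wps; apply: proj0_defined dq' _ => v vq ve.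
by exists z; split; [exists q'|exists e''].
Qed.
Definition mem_chain := s2val (cid2 mem_chain_exists).
Lemma mem_chain_in : Q mem_chain.
Proof. exact: s2valP (cid2 mem_chain_exists). Qed.
Definition mem_chain_spec := s2valP' (cid2 mem_chain_exists).
Local Hint Resolve mem_chain_in : inQ.

(** By induction on the middle set: an element of either outer set is first moved into the middle
    set, so the equations to be composed have an element of that set in the middle. *)
Lemma req_trans_exists : exists2 b, Q b &
  forall e e', defined (ap b e) (fun g =>
  defined (ap g e') (fun r => forall b a c, req e a b -> req e' b c ->
  req r a c)).
Proof.
apply: (poly_realizer C (t := PC fixc @@ lam (lam (lam (PC ret @@ ppair
  (lam (PC mem_chain @@ $3 @@ (PC eq_forward @@ $2 @@ $0) @@
    lam (PC eq_forward @@ $2 @@ $0)))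
  (lam (PC mem_chain @@ $3 @@ (PC eq_backward @@ $1 @@ $0) @@
    lam (PC eq_backward @@ $3 @@ $0)))))))).
  by inQ.
wps; apply: (wp_lam C) => F FP; wps;
  apply: definedW (fixc_spec F) _ => G GP e e'.
apply: (defined2_forall (UNat 0)) => b.
elim: b e e' => [n|X p c IH] e e'; apply: GP; apply: FP;
  apply: (wp_lam C) => h hP;
  apply: hP; apply: (wp_lam C) => h' h'P; apply: h'P; wps;
    apply: (wp_lam C) => g gP;
  apply: (wp_lam C) => f fP q qf qg; wps; apply: ret_spec => r jr a c' ab bc.
  by rewrite (req_nat_r ab) (req_nat_l bc); constructor.
have sa := (req_uset ab).2 I; have sc := (req_uset bc).1 I.
apply: (req_intro jr qf qg) => // q' x.
- move=> ax; apply: fP; wps; apply: (wp_lam C) => u uP; wps.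
  apply: defined2W (eq_forward_spec ab ax) _ => m xb; wps.
  apply: (mem_chain_spec xb) => [q'' y by_|_ y e1 e2 z [i [_ <-]] xy yz].
    by apply: uP; wps; apply: eq_forward_spec bc by_.
  by apply: defined2W (IH i e1 e2) _ => r' H; apply: H xy yz.
- move=> cx; apply: gP; wps; apply: (wp_lam C) => u uP; wps.
  apply: defined2W (eq_backward_spec bc cx) _ => m xb; wps.
  apply: (mem_chain_spec xb) => [q'' y by_|_ y e1 e2 z [i [_ <-]] xy yz].
    by apply: uP; wps; apply: eq_backward_spec ab by_.
  by apply: defined2W (IH i e1 e2) _ => r' H; apply: H xy yz.
Qed.
Definition req_trans := s2val (cid2 req_trans_exists).
Lemma req_trans_in : Q req_trans.
Proof. exact: s2valP (cid2 req_trans_exists). Qed.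
Definition req_trans_spec := s2valP' (cid2 req_trans_exists).
Local Hint Resolve req_trans_in : inQ.

Lemma mem_intro_exists : exists2 b, Q b & forall p c a, inpair p c a ->
  defined (ap b p) (fun r => rmem r c a).
Proof.
apply: (poly_realizer C (t := lam (PC ret @@ ppair $0 (PC req_refl)))).
  by inQ.
apply: (wp_lam C) => f fP p c a pc; apply: fP; wps => v v0 v1; wps.
by apply: ret_spec => r jr; apply: (rmem_intro jr v0 v1 pc (req_refl_spec c)).
Qed.
Definition mem_intro := s2val (cid2 mem_intro_exists).
Lemma mem_intro_in : Q mem_intro.
Proof. exact: s2valP (cid2 mem_intro_exists). Qed.
Definition mem_intro_spec := s2valP' (cid2 mem_intro_exists).
Local Hint Resolve mem_intro_in : inQ.

Lemma mem_eq_l_exists : exists2 b, Q b & forall e m a a' b',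
  req e a a' -> rmem m a b' ->
  defined (ap b e) (fun g => defined (ap g m) (fun r => rmem r a' b')).
Proof.
apply: (poly_realizer C (t := lam (lam (PC map @@
  lam (ppair (ppr0 $0) (PC req_trans @@ (PC req_sym @@ $2) @@ ppr1 $0)) @@
    $0)))).
  by inQ.
apply: (wp_lam C) => f fP e m a a' b' aa' /memE ab; apply: fP;
  apply: (wp_lam C) => g gP.
apply: gP; wps; apply: (wp_lam C) => h hP; wps.
apply: (map_spec ab) => [d [c [[q [dq bc]] [e1 [de1 ac]]]]|r rm]; last first.
  by apply/memE; exact: rm.
apply: hP; wps; apply: proj1_defined de1 _; wps.
apply: definedW (req_sym_spec e) _ => e' /(_ _ _ aa') a'a; wps.
apply: defined2W (req_trans_spec e' e1) _ => e2 /(_ _ _ _ a'a ac) a'c; wps.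
apply: proj0_defined dq _ => v vq ve.
by exists c; split; [exists q|exists e2].
Qed.
Definition mem_eq_l := s2val (cid2 mem_eq_l_exists).
Lemma mem_eq_l_in : Q mem_eq_l.
Proof. exact: s2valP (cid2 mem_eq_l_exists). Qed.
Definition mem_eq_l_spec := s2valP' (cid2 mem_eq_l_exists).
Local Hint Resolve mem_eq_l_in : inQ.

Lemma mem_eq_r_exists : exists2 b, Q b & forall e m a a' x,
  req e a a' -> rmem m x a ->
  defined (ap b e) (fun g => defined (ap g m) (fun r => rmem r x a')).
Proof.
apply: (poly_realizer C (t := lam (lam (PC mem_chain @@ PC req_trans @@ $0 @@
  lam (PC eq_forward @@ $2 @@ $0))))); first by inQ.
apply: (wp_lam C) => f fP e m a a' x aa' xa; apply: fP;
  apply: (wp_lam C) => g gP.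
apply: gP; wps; apply: (wp_lam C) => h hP; wps.
apply: (mem_chain_spec xa) => [q y ya|q y e1 e2 z _ xy yz].
  by apply: hP; wps; apply: eq_forward_spec aa' ya.
by apply: defined2W (req_trans_spec e1 e2) _ => r; apply; [apply: xy|].
Qed.
Definition mem_eq_r := s2val (cid2 mem_eq_r_exists).
Lemma mem_eq_r_in : Q mem_eq_r.
Proof. exact: s2valP (cid2 mem_eq_r_exists). Qed.
Definition mem_eq_r_spec := s2valP' (cid2 mem_eq_r_exists).
Local Hint Resolve mem_eq_r_in : inQ.

(** * Stability under the jump and substitution of equals *)

Local Notation rz := (realizes ap s k j).

Lemma num_defined n : defined (num n) (fun=> True).
Proof.
elim: n => [|n [x [nx _]]] /=; first exact: definedW (cIP C) _.
have [y [yE _]] := cKIP C.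
by rewrite nx yE; apply: definedW (cpairP C _ _) _.
Qed.

(** Zero is the identity, so its first projection is [k]; that of a successor is [k i]. Hence [p0]
    of a numeral, applied to two arguments, is a test for zero that selects one of them. *)
Lemma proj0_num0 x : num 0 = Some x -> p0 (Some x) = Some k.
Proof.
move=> /= xE; have [i [iE iP]] := cIP C.
by apply: (proj0E C); move: iE; rewrite xE => -[->].
Qed.

Lemma projS_num n x : num n.+1 = Some x ->
  p0 (Some x) = cKI ap s k /\ p1 (Some x) = num n.
Proof.
move=> /= xE; have [y [nE _]] := num_defined n; have [z [zE _]] := cKIP C.
move: xE; rewrite zE nE; have [p [-> [pz py]]] := cpairP C z y.
by move=> [<-].
Qed.

Lemma k2P a b (R : baire -> Prop) :
  R a -> defined (ap k a) (fun g => defined (ap g b) R).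
Proof. by move=> Ra; apply: definedW (kP C a) _ => g ->; exists a. Qed.

(* Every realizability predicate is closed under j, uniformly: numbers because
   a singleton j(e) can be evaluated, the other clauses because they are
   guarded by j, built from such by products and exponents, or independent of
   the realizer. *)
Lemma stable_exists n (A : form n) : exists2 b, Q b & forall rho e,
  forallp (j e) (rz A rho) -> defined (ap b e) (rz A rho).
Proof.
have joinQ (R : baire -> Prop) e : forallp (j e) (fun d => forallp (j d) R) ->
    defined (ap join e) (fun r => forallp (j r) R).
  exact: (jjoinP M (R := R)).
elim: A => {n}.
- move=> n k' r v; exists k => // rho e /forallp_ex [d] /= H.
  exact: definedW (kP C e) _.
- move=> n x; exists ext => [|rho e eN]; first exact: ext_in.
  (* All elements of j(e) are the numeral of the same number, so j(e) is a singleton, which [ext]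
     evaluates. *)
  have [d [m [xm dm]]] := forallp_ex eN.
  apply: (@ext_spec e d); last by exists m.
  apply: forallpW eN _ => d' [m' []]; rewrite xm => -[<-].
  by rewrite -dm => -[->].
- move=> n x; exists k => // rho e /forallp_ex [d] /= H.
  exact: definedW (kP C e) _.
- move=> n x y; exists join => // rho e /= H.
  apply: definedW (joinQ _ _ (forallpW H (fun d => (memE d _ _).1))) _ => r.
  by move/memE.
(* Plain [join] fails here: realizers of an equation between numbers are arbitrary, and their own
   jumps may be undefined. The equation is rebuilt as two closures under [ret]. *)
- move=> n x y; apply: (poly_realizer C (t := lam (PC ret @@ ppair
    (lam (PC bind @@ lam (PC eq_forward @@ $0 @@ $1) @@ $1))
    (lam (PC bind @@ lam (PC eq_backward @@ $0 @@ $1) @@ $1))))); first by inQ.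
  apply: (wp_lam C) => b bP rho e /= eq; apply: bP; wps;
    apply: (wp_lam C) => g gP.
  apply: (wp_lam C) => f fP q qf qg; wps; apply: ret_spec => r jr.
  have [d dE] := forallp_ex eq.
  case xE: (rho x) => [m|X p c]; first by rewrite xE in dE;
    rewrite (req_nat_l dE); constructor.
  have sx : is_uset (rho x) by rewrite xE.
  have uy := (req_uset dE).1 sx; rewrite -xE.
  apply: (req_intro jr qf qg) => // p' c' ac.
  + apply: fP; wps; apply: (wp_lam C) => h hP; wps.
    apply: (bind_spec eq) => [d' dE'|r' rm]; last by apply/memE; apply: rm.
    apply: hP; wps; apply: defined2W (eq_forward_spec dE' ac) _ => r';
      by move/memE.
  + apply: gP; wps; apply: (wp_lam C) => h hP; wps.
    apply: (bind_spec eq) => [d' dE'|r' rm]; last by apply/memE; apply: rm.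
    apply: hP; wps; apply: defined2W (eq_backward_spec dE' ac) _ => r';
      by move/memE.
- move=> n A [a Qa aP] B [b Qb bP].
  apply: (poly_realizer C (t := lam (ppair
    (PC a @@ (PC map @@ lam (ppr0 $0) @@ $0))
    (PC b @@ (PC map @@ lam (ppr1 $0) @@ $0))))); first by inQ.
  apply: (wp_lam C) => f fP rho e /= eAB; apply: fP; wps;
    apply: (wp_lam C) => g gP; wps.
  apply: (map_spec eAB (R' := rz B rho)) => [d [_ dB]|r rB].
    by apply: gP; wps.
  wps; apply: definedW (bP _ _ rB) _ => r' r'B; wps;
    apply: (wp_lam C) => h hP; wps.
  apply: (map_spec eAB (R' := rz A rho)) => [d [dA _]|r'' rA].
    by apply: hP; wps.
  wps; apply: definedW (aP _ _ rA) _ => r3 r3A v va vb.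
  by rewrite va vb; split; [exists r3|exists r'].
- by move=> n A _ B _; exists join => // rho e /joinQ.
- move=> n A _; exists k => // rho e /forallp_ex [d] /= H.
  exact: definedW (kP C e) _.
- move=> n A _ B [b Qb bP].
  apply: (poly_realizer C (t := lam (lam
    (PC b @@ (PC map @@ lam ($0 @@ $1) @@ $1))))); first by inQ.
  apply: (wp_lam C) => f fP rho e /= eAB; apply: fP;
    apply: (wp_lam C) => g gP a aA.
  apply: gP; wps; apply: (wp_lam C) => h hP; wps.
  apply: (map_spec eAB (R' := rz B rho)) => [d dAB|r rB].
    by apply: hP; wps; apply: dAB.
  by wps; apply: bP.
- by move=> n A _; exists join => // rho e /joinQ.
- by move=> n A _; exists join => // rho e /joinQ.
Qed.

(** The mask [m] marks the variables replaced along the single equation realized by [e]; unmarked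
    variables use reflexivity. Under a quantifier the bound variable is left unmarked. Negation and
    implication need the reverse substitution for the premise, hence the symmetry of the hypothesis
    ([syM]). *)
Lemma subst_eq_exists n (A : form n) : forall m : vars n -> bool,
  exists2 b, Q b & forall (rho rho' : vars n -> universe) e,
  (forall i, if m i then req e (rho i) (rho' i) else rho i = rho' i) ->
  forall a, rz A rho a ->
  defined (ap b e) (fun g => defined (ap g a) (rz A rho')).
Proof.
have syM n' (m : vars n' -> bool) (rho rho' : vars n' -> universe) e e' :
    (forall a a', req e a a' -> req e' a' a) ->
    (forall i, if m i then req e (rho i) (rho' i) else rho i = rho' i) ->
    forall i, if m i then req e' (rho' i) (rho i) else rho' i = rho i.
  by move=> ee' H i; have := H i; case: (m i) => // /ee'.
have eqM n' (m : vars n' -> bool) (rho rho' : vars n' -> universe) e t sg R i :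
    (forall i, if m i then req e (rho i) (rho' i) else rho i = rho' i) ->
    wp ap sg t (eq e) ->
    (forall r, req r (rho i) (rho' i) -> R r) ->
    wp ap sg (if m i then t else PC req_refl) R.
  move=> H te RR; have := H i; case: (m i) => E.
    by apply: definedW te _ => _ <-; apply: RR.
  by apply: wp_cst; apply: RR; rewrite E; apply: req_refl_spec.
have natM n' (m : vars n' -> bool) (rho rho' : vars n' -> universe) e i x :
    (forall i, if m i then req e (rho i) (rho' i) else rho i = rho' i) ->
    rho i = UNat x -> rho' i = UNat x.
  by move=> H E; have := H i; case: (m i); rewrite E // => /req_nat_l.
have inE n' (m : vars n' -> bool) i t : poly_in Q t ->
  poly_in Q (if m i then t else PC req_refl) by case: (m i) => // _; inQ.
elim: A => {n}.
- move=> n k' r v m; apply: (poly_realizer C (t := lam (lam $0))).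
    by inQ.
  apply: (wp_lam C) => f fP rho rho' e H a [xs [vx rx]]; apply: fP.
  apply: (wp_lam C) => g gP; apply: gP; wps; exists xs; split=> // i.
  exact: natM H (vx i).
- move=> n x m; apply: (poly_realizer C (t := lam (lam $0))).
    by inQ.
  apply: (wp_lam C) => f fP rho rho' e H a [p [xp aE]]; apply: fP.
  apply: (wp_lam C) => g gP; apply: gP; wps; exists p; split=> //.
  exact: natM H xp.
- move=> n x m; apply: (poly_realizer C (t := lam (lam $0))).
    by inQ.
  apply: (wp_lam C) => f fP rho rho' e H a xs; apply: fP.
  apply: (wp_lam C) => g gP; apply: gP; wps; move: xs (H x) => /= xs.
  by case: (m x) => [/req_uset [xx _]|<-] //; apply: xx.
- move=> n x y m; apply: (poly_realizer C (t := lam (lam (PC mem_eq_r @@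
    (if m y then $1 else PC req_refl) @@
    (PC mem_eq_l @@ (if m x then $1 else PC req_refl) @@ $0))))).
    by inQ; apply: inE.
  apply: (wp_lam C) => f fP rho rho' e H a xs; apply: fP.
  apply: (wp_lam C) => g gP; apply: gP; wps; apply: (eqM _ _ _ _ _ _ _ _ _ H).
    by wps.
  move=> r rx; wps; apply: defined2W (mem_eq_l_spec rx xs) _ => r' r'm; wps.
  apply: (eqM _ _ _ _ _ _ _ _ _ H); first by wps.
  by move=> r'' ry; wps; apply: mem_eq_r_spec ry r'm.
- move=> n x y m; apply: (poly_realizer C (t := lam (lam (PC req_trans @@
    (PC req_trans @@ (PC req_sym @@ (if m x then $1 else PC req_refl)) @@ $0) @@
    (if m y then $1 else PC req_refl))))).
    by inQ; apply: inE.
  apply: (wp_lam C) => f fP rho rho' e H a xs; apply: fP.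
  apply: (wp_lam C) => g gP; apply: gP; wps; apply: (eqM _ _ _ _ _ _ _ _ _ H).
    by wps.
  move=> ry ryE; wps; apply: (eqM _ _ _ _ _ _ _ _ _ H); first by wps.
  move=> rx rxE; wps;
    apply: definedW (req_sym_spec rx) _ => rx' /(_ _ _ rxE) rxE'.
  wps; apply: defined2W (req_trans_spec rx' a) _ => r /(_ _ _ _ rxE' xs) rE;
    wps.
  by apply: defined2W (req_trans_spec r ry) _ => r' /(_ _ _ _ rE ryE).
- move=> n A IHA B IHB m; have [a Qa aP] := IHA m; have [b Qb bP] := IHB m.
  apply: (poly_realizer C (t := lam (lam (ppair
    (PC a @@ $1 @@ ppr0 $0) (PC b @@ $1 @@ ppr1 $0))))); first by inQ.
  apply: (wp_lam C) => f fP rho rho' e H d /= [[x [dx xA]] [y [dy yB]]];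
    apply: fP.
  apply: (wp_lam C) => g gP; apply: gP; wps; apply: proj1_defined dy _; wps.
  apply: defined2W (bP _ _ _ H _ yB) _ => r rB; wps.
  apply: proj0_defined dx _; wps.
  apply: defined2W (aP _ _ _ H _ xA) _ => r' r'A v v0 v1.
  by rewrite v0 v1; split; [exists r'|exists r].
- move=> n A IHA B IHB m; have [a Qa aP] := IHA m; have [b Qb bP] := IHB m.
  (* The tag of the disjunction is the numeral 0 or 1; its first projection is a selector, which
     picks the substitution realizer of the matching disjunct. *)
  apply: (poly_realizer C (t := lam (lam (PC map @@ (lam (ppair (ppr0 $0)
    (ppr0 (ppr0 $0) @@ PC a @@ PC b @@ $2 @@ ppr1 $0))) @@ $0)))).
    by inQ.
  apply: (wp_lam C) => f fP rho rho' e H d /= dAB; apply: fP.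
  apply: (wp_lam C) => g gP; apply: gP; wps; apply: (wp_lam C) => h hP; wps.
  apply: (map_spec dAB) => [d'|r]; last exact.
  move=> [[d'0 [x [d'1 xA]]]|[d'0 [x [d'1 xB]]]]; apply: hP; wps;
      apply: proj1_defined d'1 _; wps.
  + have [z [zE _]] := num_defined 0; 
    have d'z : p0 (Some d') = Some z by rewrite -zE.
    apply: (proj0_defined d'z); wps; apply: proj0_defined (proj0_num0 zE) _.
    apply: k2P; apply: defined2W (aP _ _ _ H _ xA) _ => r rA; wps.
    apply: (proj0_defined d'z) => v v0 v1; left; rewrite v0 v1.
    by split; [rewrite -zE|exists r].
  + have [z [zE _]] := num_defined 1; 
    have d'z : p0 (Some d') = Some z by rewrite -zE.
    apply: (proj0_defined d'z); wps; rewrite (projS_num zE).1.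
    apply: definedW (cKIP C) _ => ki kiP; apply: definedW (kiP _) _ => i iP.
    rewrite iP; exists b; split=> //.
    apply: defined2W (bP _ _ _ H _ xB) _ => r rB; wps.
    apply: (proj0_defined d'z) => v v0 v1; right; rewrite v0 v1.
    by split; [rewrite -zE|exists r].
- move=> n A IHA m; have [a Qa aP] := IHA m.
  apply: (poly_realizer C (t := lam (lam $0))); first by inQ.
  apply: (wp_lam C) => f fP rho rho' e H d dA; apply: fP.
  apply: (wp_lam C) => g gP; apply: gP; wps => c cA.
  have [e' [_ ee']] := req_sym_spec e.
  have [? [_ [r [_ rA]]]] := aP _ _ _ (syM _ _ _ _ _ _ ee' H) _ cA.
  exact: dA rA.
- move=> n A IHA B IHB m; have [a Qa aP] := IHA m; have [b Qb bP] := IHB m.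
  apply: (poly_realizer C (t := lam (lam (lam
    (PC b @@ $2 @@ ($1 @@ (PC a @@ (PC req_sym @@ $2) @@ $0)))))));
      first by inQ.
  apply: (wp_lam C) => f fP rho rho' e H d dAB; apply: fP.
  apply: (wp_lam C) => g gP; apply: gP; apply: (wp_lam C) => h hP c cA;
    apply: hP; wps.
  apply: definedW (req_sym_spec e) _ => e' ee'; wps.
  apply: defined2W (aP _ _ _ (syM _ _ _ _ _ _ ee' H) _ cA) _ => r rA; wps.
  apply: definedW (dAB _ rA) _ => r' r'B; wps.
  exact: bP H _ r'B.
- move=> n A IHA m; have [a Qa aP] := IHA (scons false m).
  apply: (poly_realizer C (t := lam (lam (PC map @@ lam (PC a @@ $2 @@ $0)
    @@ $0)))); first by inQ.
  apply: (wp_lam C) => f fP rho rho' e H d dA; apply: fP.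
  apply: (wp_lam C) => g gP; apply: gP; wps; apply: (wp_lam C) => h hP; wps.
  apply: (map_spec dA) => [d' d'A|r]; last exact.
  apply: hP; wps; apply: (defined2_forall (UNat 0)) => c.
  by apply: aP (d'A c); case.
- move=> n A IHA m; have [a Qa aP] := IHA (scons false m).
  apply: (poly_realizer C (t := lam (lam (PC map @@ lam (PC a @@ $2 @@ $0)
    @@ $0)))); first by inQ.
  apply: (wp_lam C) => f fP rho rho' e H d dA; apply: fP.
  apply: (wp_lam C) => g gP; apply: gP; wps; apply: (wp_lam C) => h hP; wps.
  apply: (map_spec dA) => [d' [c d'A]|r]; last exact.
  apply: hP; wps.
  apply: defined2W (aP (scons c rho) (scons c rho') _ _ _ d'A) _.
    by case.
  by move=> r rA; exists c.
Qed.

Definition stable n (A : form n) := s2val (cid2 (stable_exists A)).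
Lemma stable_in n (A : form n) : Q (stable A).
Proof. exact: s2valP (cid2 (stable_exists A)). Qed.
Lemma stable_spec n (A : form n) rho e :
  forallp (j e) (rz A rho) -> defined (ap (stable A) e) (rz A rho).
Proof. exact: (s2valP' (cid2 (stable_exists A))). Qed.
Local Hint Resolve stable_in : inQ.

Definition subst_eq n (A : form n) m := s2val (cid2 (subst_eq_exists A m)).
Lemma subst_eq_in n (A : form n) m : Q (subst_eq A m).
Proof. exact: s2valP (cid2 (subst_eq_exists A m)). Qed.
Lemma subst_eq_spec n (A : form n) m rho rho' e a :
  (forall i, if m i then req e (rho i) (rho' i) else rho i = rho' i) ->
  rz A rho a ->
    defined (ap (subst_eq A m) e) (fun g => defined (ap g a) (rz A rho')).
Proof. by move=> H; apply: (s2valP' (cid2 (subst_eq_exists A m))) H _. Qed.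
Local Hint Resolve subst_eq_in : inQ.

Lemma realizes_ren n m (f : vars n -> vars m) (A : form n) rho :
  rz (ren f A) rho = rz A (fun x => rho (f x)).
Proof.
have sc n' m' (f' : vars n' -> vars m') c (rho' : vars m' -> universe) :
    (fun x => scons c rho' (omap f' x)) = scons c (fun x => rho' (f' x)).
  by apply/funext => -[x|].
elim: A m f rho => {n} //=.
- by move=> n A IHA B IHB m f rho; rewrite IHA IHB.
- by move=> n A IHA B IHB m f rho; rewrite IHA IHB.
- by move=> n A IHA m f rho; rewrite IHA.
- by move=> n A IHA B IHB m f rho; rewrite IHA IHB.
- move=> n A IHA m f rho; apply/funext => e; congr forallp.
  by apply/funext => d; apply: eq_forall => c; rewrite IHA sc.
- move=> n A IHA m f rho; apply/funext => e; congr forallp.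
  by apply/funext => d; apply: eq_exists => c; rewrite IHA sc.
Qed.

(** * Rules for realizing compound formulas *)

Lemma wp_all sg t n (A : form n.+1) rho :
  (forall c, wp ap sg t (rz A (scons c rho))) ->
  wp ap sg (PC ret @@ t) (rz (FAll A) rho).
Proof.
move=> H; wps; apply: definedW (defined_forall (UNat 0) H) _ => d dA; wps.
apply: ret_spec => r jr; apply: forallpW jr _ => _ <- c; exact: dA.
Qed.

Lemma wp_ex sg t n (A : form n.+1) rho c :
  wp ap sg t (rz A (scons c rho)) ->
  wp ap sg (PC ret @@ t) (rz (FEx A) rho).
Proof.
move=> H; wps; apply: definedW H _ => d dA; wps.
by apply: ret_spec => r jr; apply: forallpW jr _ => _ <-; exists c.
Qed.

Lemma wp_imp sg t n (A B : form n) rho :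
  (forall a, rz A rho a -> wp ap (pcons a sg) t (rz B rho)) ->
  wp ap sg (lam t) (rz (FImp A B) rho).
Proof. by move=> H; apply: (wp_lam C) => f fP a /H; apply: fP. Qed.

Lemma wp_and sg t u n (A B : form n) rho :
  wp ap sg u (rz B rho) -> wp ap sg t (rz A rho) ->
  wp ap sg (ppair t u) (rz (FAnd A B) rho).
Proof.
move=> uB tA; wps; apply: definedW uB _ => y yB; apply: definedW tA _ => x xA.
by move=> v vx vy; split; rewrite ?vx ?vy; [exists x|exists y].
Qed.

Lemma wp_allset sg t n (A : form n.+1) rho :
  (forall c a, is_uset c -> wp ap (pcons a sg) t (rz A (scons c rho))) ->
  wp ap sg (PC ret @@ lam t) (rz (FAllSet A) rho).
Proof. by move=> H; apply: wp_all => c; apply: wp_imp => a; apply: H. Qed.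

Lemma wp_exset sg t n (A : form n.+1) rho c : is_uset c ->
  wp ap sg t (rz A (scons c rho)) ->
  wp ap sg (PC ret @@ ppair (PC k) t) (rz (FExSet A) rho).
Proof.
by move=> sc H; apply: (wp_ex (c := c)); apply: wp_and => //; apply: wp_cst.
Qed.

(** The shape shared by pairing, union, power set, infinity and separation. The component [PC k] is
    a dummy for the realizer of being a set, which carries no information. *)
Lemma wp_compr sg t u n (A : form n.+2) rho c : is_uset c ->
  (forall x m, rmem m x c ->
    wp ap (pcons m sg) t (rz A (scons x (scons c rho)))) ->
  (forall x m, rz A (scons x (scons c rho)) m ->
    wp ap (pcons m sg) u (fun r => rmem r x c)) ->
  wp ap sg (PC ret @@ ppair (PC k) (PC ret @@ ppair (lam t) (lam u)))
    (rz (FExSet (FAll (FIff (@FMem n.+2 None (Some None)) A))) rho).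
Proof.
move=> sc Ht Hu; apply: (wp_exset sc); apply: wp_all => x.
by apply: wp_and; apply: wp_imp => a; [apply: Hu|apply: Ht].
Qed.

(** * Universal closures and numerals *)

Definition realized n (A : form n) : Prop :=
  exists2 e, Q e & forall rho, rz A rho e.

Lemma realizedI n (A : form n) t : poly_in Q t ->
  (forall rho, wp ap (fun=> k) t (rz A rho)) -> realized A.
Proof.
move=> Qt tA; apply: (poly_realizer C Qt).
exact: (defined_forall (fun=> UNat 0) tA).
Qed.

Lemma close_realized n (A : form n) : realized A -> realized (close A).
Proof.
elim: n A => [|n IH] A //= [e Qe eA]; apply: IH.
apply: (realizedI (t := PC ret @@ PC e)) => [|rho]; first by inQ.
by apply: wp_all => c; apply: wp_cst.
Qed.

(** The realizer of a closure over the numbers receives its numerals one at a time and collects them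
    in nested pairs, the innermost variable in front. The empty tuple may be coded by anything. *)
Fixpoint tup n : (vars n -> nat) -> baire -> Prop :=
  if n is m.+1 then fun xs v => p0 (Some v) = num (xs None) /\
    defined (p1 (Some v)) (tup (fun i => xs (Some i)))
  else fun _ _ => True.

Definition nenv n (xs : vars n -> nat) : vars n -> universe :=
  fun i => UNat (xs i).

Lemma nenv_scons n x (xs : vars n -> nat) :
  scons (UNat x) (nenv xs) = nenv (scons x xs : vars n.+1 -> nat).
Proof. by apply/funext => -[i|]. Qed.

Definition realizedN n (A : form n) : Prop := exists2 e, Q e &
  forall xs v, tup xs v -> defined (ap e v) (rz A (nenv xs)).

Lemma closeN_realized n (A : form n) : realizedN A -> realized (closeN A).
Proof.
elim: n A => [|n IH] A /= [e Qe eA].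
  apply: (realizedI (t := PC e @@ PC k)) => [|rho]; first by inQ.
  wps; apply: definedW (eA (fun=> 0) k I) _ => r.
  by congr (rz A _ r); apply/funext => -[].
apply: IH; apply: (poly_realizer C
  (t := lam (PC ret @@ lam (PC e @@ ppair $0 $1)))); first by inQ.
apply: (wp_lam C) => f fP xs v xv; apply: fP; apply: wp_all => c.
apply: wp_imp => a [m [/= -> aE]]; wps => w w0 w1; wps.
apply: definedW (eA (scons m xs : vars n.+1 -> nat) w _) _ => [|r].
  by rewrite /= w0 aE; split=> //; exists v.
by rewrite nenv_scons.
Qed.

Lemma realizedN_cst n (A : form n) t : poly_in Q t ->
  (forall xs sg, wp ap sg t (rz A (nenv xs))) -> realizedN A.
Proof.
move=> Qt tA; apply: (poly_realizer C (t := lam t)); first by inQ.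
by apply: (wp_lam C) => f fP xs v _; apply: fP.
Qed.

Lemma realizes_rel n k' (R : prel k') (v : vars k' -> vars n) xs :
  rz (FRel R v) (nenv xs) = fun=> prel_holds R (fun i => xs (v i)).
Proof.
apply/funext => e; apply/propext; split=> [[ys [vy]]|H].
  by congr prel_holds; apply/funext => i; have [] := vy i.
by exists (fun i => xs (v i)).
Qed.

Lemma realizes_graph n k' (f : prf k') (v : vars k' -> vars n) y xs :
  rz (Graph f v y) (nenv xs) =
  fun=> prf_eval f (fun i => xs (v i)) = xs y.
Proof. exact: realizes_rel. Qed.

Lemma realizes_and_exists n (A B : form n) rho e : rz (FAnd A B) rho e ->
  (exists x, rz A rho x) /\ (exists y, rz B rho y).
Proof. by move=> [[x [_ xA]] [y [_ yB]]]; split; [exists x|exists y]. Qed.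

Lemma realizes_ex_exists n (A : form n.+1) rho e : rz (FEx A) rho e ->
  exists d c, rz A (scons c rho) d.
Proof. exact: forallp_ex. Qed.

Lemma realizes_andE n (A B : form n) rho e : rz (FAnd A B) rho e =
  (defined (p0 (Some e)) (rz A rho) /\ defined (p1 (Some e)) (rz B rho)).
Proof. by []. Qed.

Lemma realizes_impE n (A B : form n) rho e : rz (FImp A B) rho e =
  forall a, rz A rho a -> defined (ap e a) (rz B rho).
Proof. by []. Qed.

Lemma realizes_allE n (A : form n.+1) rho e : rz (FAll A) rho e =
  forallp (j e) (fun d => forall c, rz A (scons c rho) d).
Proof. by []. Qed.

Lemma realizes_exE n (A : form n.+1) rho e : rz (FEx A) rho e =
  forallp (j e) (fun d => exists c, rz A (scons c rho) d).
Proof. by []. Qed.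

(** * Computing with numerals *)

Lemma num_zero_exists : exists2 z, Q z & num 0 = Some z.
Proof.
apply: (poly_realizer C (t := pI s k)); first by rewrite /pI; inQ.
by have [i [iE _]] := cIP C; exists i.
Qed.
Definition num_zero := s2val (cid2 num_zero_exists).
Lemma num_zero_in : Q num_zero.
Proof. exact: s2valP (cid2 num_zero_exists). Qed.
Definition num_zeroE := s2valP' (cid2 num_zero_exists).
Local Hint Resolve num_zero_in : inQ.

Lemma num_succ_exists : exists2 b, Q b & forall n x, num n = Some x ->
  defined (ap b x) (fun r => num n.+1 = Some r).
Proof.
apply: (poly_realizer C (t := lam (ppair (PC k @@ pI s k) $0))).
  by rewrite /pI; inQ.
apply: (wp_lam C) => b bP n x nx; apply: bP => /=; rewrite nx.
have [ki [kiE _]] := cKIP C; have [r [rE _]] := cpairP C ki x.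
by exists r; rewrite kiE; split=> //; rewrite -rE -kiE.
Qed.
Definition num_succ := s2val (cid2 num_succ_exists).
Lemma num_succ_in : Q num_succ.
Proof. exact: s2valP (cid2 num_succ_exists). Qed.
Definition num_succ_spec := s2valP' (cid2 num_succ_exists).
Local Hint Resolve num_succ_in : inQ.

(** The test for zero selects a branch. Since evaluation is strict, both branches are wrapped in an
    abstraction and the chosen one is run on the dummy [k]; otherwise the recursive call would be
    evaluated at zero too. *)
Lemma natrec_exists : exists2 b, Q b & forall a f (R : nat -> baire ->
  Prop), R 0 a ->
  (forall m x r, num m = Some x -> R m r ->
    defined (ap f x) (fun g => defined (ap g r) (R m.+1))) ->
  forall m x, num m = Some x ->
  defined (ap b a) (fun g => defined (ap g f) (fun h =>
    defined (ap h x) (R m))).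
Proof.
apply: (poly_realizer C (t := lam (lam (lam (PC fixc @@ lam (lam (ppr0 $0 @@
  lam $5 @@ lam ($4 @@ ppr1 $1 @@ ($2 @@ ppr1 $1)) @@ PC k)) @@ $0))))).
  by inQ.
apply: (wp_lam C) => b bP a f R Ra fR m x mx; apply: bP;
  apply: (wp_lam C) => g gP; apply: gP.
apply: (wp_lam C) => h hP; apply: hP; wps; apply: (wp_lam C) => F FP; wps.
apply: definedW (fixc_spec F) _ => G GP.
suff H m' x' : num m' = Some x' -> defined (ap G x') (R m') by apply: H.
elim: m' x' {m mx} => [|m IH] x' mx; apply: GP; apply: FP;
  apply: (wp_lam C) => h' h'P;
  apply: h'P; wps; apply: (wp_lam C) => u uP; wps; apply: (wp_lam C) => v vP;
    wps.
- apply: (proj0_defined (proj0_num0 mx)); apply: k2P; apply: vP; by wps.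
- have [-> x1] := projS_num mx; have [y [my _]] := num_defined m.
  rewrite my in x1; apply: definedW (cKIP C) _ => ki kiP.
  apply: definedW (kiP _) _ => i iP; rewrite iP; exists u; split=> //.
  apply: uP; wps; apply: (proj1_defined x1); wps.
  apply: definedW (IH _ my) _ => r rR; wps; apply: (proj1_defined x1); wps.
  exact: fR.
Qed.
Definition natrec := s2val (cid2 natrec_exists).
Lemma natrec_in : Q natrec.
Proof. exact: s2valP (cid2 natrec_exists). Qed.
Definition natrec_spec := s2valP' (cid2 natrec_exists).
Local Hint Resolve natrec_in : inQ.

Definition computable n (F : (vars n -> nat) -> nat) : Prop :=
  exists2 b, Q b & forall xs v, tup xs v ->
  defined (ap b v) (fun r => num (F xs) = Some r).

Lemma computable_proj n (i : vars n) : computable (fun xs => xs i).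
Proof.
elim: n i => [[]|n IH [i|]].
- have [b Qb bP] := IH i.
  apply: (poly_realizer C (t := lam (PC b @@ ppr1 $0))); first by inQ.
  apply: (wp_lam C) => f fP xs v [_ [w [vw xw]]]; apply: fP; wps.
  by apply: (proj1_defined vw); wps; apply: bP xw.
- apply: (poly_realizer C (t := lam (ppr0 $0))); first by inQ.
  apply: (wp_lam C) => f fP xs v [v0 _]; apply: fP; wps.
  have [x [xE _]] := num_defined (xs None); rewrite v0 xE.
  by exists x.
Qed.

Lemma computable_tuple n m (F : vars m -> (vars n -> nat) -> nat) :
  (forall i, computable (F i)) ->
  exists2 b, Q b & forall xs v, tup xs v ->
    defined (ap b v) (tup (fun i => F i xs)).
Proof.
elim: m F => [|m IH] F FC.
  apply: (poly_realizer C (t := lam $0)); first by inQ.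
  by apply: (wp_lam C) => f fP xs v _; apply: fP; wps.
have [b Qb bP] := IH (fun i => F (Some i)) (fun i => FC (Some i)).
have [c Qc cP] := FC None.
apply: (poly_realizer C (t := lam (ppair (PC c @@ $0) (PC b @@ $0)))).
  by inQ.
apply: (wp_lam C) => f fP xs v xv; apply: fP; wps.
apply: definedW (bP _ _ xv) _ => y yP; wps.
apply: definedW (cP _ _ xv) _ => x xP p px py.
by split; [rewrite px xP|rewrite py; exists y].
Qed.

(** Totality of the graphs needs this, since its realizer must produce the numeral of the value. The
    remaining axioms on graphs only state facts about numbers, and realizers independent of the
    arguments suffice. *)
Lemma prf_computable n (f : prf n) : computable (prf_eval f).
Proof.
elim: f => {n}.
- apply: (poly_realizer C (t := lam (PC num_zero))); first by inQ.
  by apply: (wp_lam C) => f fP xs v _; apply: fP; wps; apply: num_zeroE.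
- apply: (poly_realizer C (t := lam (PC num_succ @@ ppr0 $0))); first by inQ.
  apply: (wp_lam C) => f fP xs v [v0 _]; apply: fP; wps.
  have [x [xE _]] := num_defined (xs None); rewrite v0 xE.
  by exists x; split=> //; wps; apply: num_succ_spec xE.
- by move=> n i; apply: computable_proj.
- move=> n m f [a Qa aP] g /computable_tuple [b Qb bP].
  apply: (poly_realizer C (t := lam (PC a @@ (PC b @@ $0)))); first by inQ.
  apply: (wp_lam C) => h hP xs v xv; apply: hP; wps.
  by apply: definedW (bP _ _ xv) _ => w wP; wps; apply: aP wP.
- move=> n f [a Qa aP] g [b Qb bP].
  apply: (poly_realizer C (t := lam (PC natrec @@ (PC a @@ ppr1 $0) @@
    lam (lam (PC b @@ ppair $1 (ppair $0 (ppr1 $2)))) @@ ppr0 $0))).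
    by inQ.
  apply: (wp_lam C) => h hP xs v [v0 [w [vw wP]]]; apply: hP; wps.
  have [x [xE _]] := num_defined (xs None); rewrite v0 xE.
  exists x; split=> //; wps; apply: (wp_lam C) => h' h'P; wps.
  apply: (proj1_defined vw); wps; apply: definedW (aP _ _ wP) _ => y yE; wps.
  pose F m := prf_eval (PRec f g) (scons m (fun i => xs (Some i))).
  apply: (natrec_spec (R := fun m r => num (F m) = Some r)) => // m z r mz rE.
  apply: h'P; apply: (wp_lam C) => h'' h''P; apply: h''P; wps.
  apply: (proj1_defined vw); wps => q q0 q1; wps => q' q'0 q'1; wps.
  apply: (bP (@scons _ n.+1 m (scons (F m) (fun i => xs (Some i))))).
  split; first by rewrite q'0 mz.
  exists q; split=> //; split; first by rewrite q0 rE.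
  by exists w.
Qed.

(** * The axioms *)

Local Notation "#0" := (None) (only parsing).
Local Notation "#1" := (Some None) (only parsing).
Local Notation "#2" := (Some (Some None)) (only parsing).
Local Notation "#3" := (Some (Some (Some None))) (only parsing).

(** * Equality, urelements and arithmetic *)

Lemma realized_refl : realized (@FEq 1 #0 #0).
Proof. by exists req_refl => [|rho];
  [apply: req_refl_in|apply: req_refl_spec]. Qed.

Lemma realized_leibniz n (A : form n.+1) :
  realized (FImp (@FEq n.+2 #1 #0)
    (FImp (@ren n.+1 n.+2 Some A) (@ren n.+1 n.+2 (omap Some) A))).
Proof.
pose m : vars n.+1 -> bool := scons true (fun=> false).
apply: (realizedI (t := lam (lam (PC (subst_eq A m) @@ $1 @@ $0)))) => [|rho].
  by inQ.
apply: wp_imp => e /= E; apply: wp_imp => a; rewrite !realizes_ren => aA; wps.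
by apply: (subst_eq_spec _ aA) => -[i|].
Qed.

Lemma realized_nat_set : realized (FImp (@FNat 1 #0) (FNot (@FSet 1 #0))).
Proof.
apply: (realizedI (t := lam $0)) => [|rho]; first by inQ.
by apply: wp_imp => e [n [/= E _]]; wps => a /=; rewrite E.
Qed.

Lemma realized_mem_set : realized (FImp (@FMem 2 #1 #0) (@FSet 2 #0)).
Proof.
apply: (realizedI (t := lam $0)) => [|rho]; first by inQ.
by apply: wp_imp => e /rmem_uset E; wps.
Qed.

Lemma realized_graph_total k' (f : prf k') :
  realizedN (FEx (FAnd (@FNat k'.+1 #0) (@Graph k'.+1 k' f Some #0))).
Proof.
have [b Qb bP] := prf_computable f.
apply: (poly_realizer C (t := lam (PC ret @@ ppair (PC b @@ $0) (PC k)))).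
  by inQ.
apply: (wp_lam C) => h hP xs v xv; apply: hP.
apply: (wp_ex (c := UNat (prf_eval f xs))); rewrite nenv_scons; apply: wp_and.
  by apply: wp_cst; rewrite realizes_graph.
wps; apply: definedW (bP _ _ xv) _ => r rE.
by exists (prf_eval f xs).
Qed.

Lemma realized_graph_uniq k' (f : prf k') :
  realizedN (FImp (FAnd
    (@Graph k'.+2 k' f (fun i => Some (Some i)) #1)
    (@Graph k'.+2 k' f (fun i => Some (Some i)) #0)) (@FEq k'.+2 #1 #0)).
Proof.
apply: (realizedN_cst (t := lam $0)) => [|xs sg]; first by inQ.
apply: wp_imp => a /realizes_and_exists [[x] + [y]].
rewrite !realizes_graph => -> F; wps.
by rewrite /= /nenv F; constructor.
Qed.

Lemma realized_rel_graph k' (f : prf k') :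
  realizedN (FIff (FRel (RZero f) id)
    (FEx (FAnd (@IsZero k'.+1 #0) (@Graph k'.+1 k' f Some #0)))).
Proof.
apply: (realizedN_cst (t := ppair (lam (PC ret @@ ppair (PC k) (PC k)))
  (lam $0))) => [|xs sg]; first by inQ.
apply: wp_and; apply: wp_imp => a.
  move=> /realizes_ex_exists [d [c /realizes_and_exists [[x cE] [y fE]]]]; wps.
  (* The witness c ranges over all of V; a primitive recursive relation holds only between numbers,
     which forces c to be one. *)
  have [ys [/(_ #0) cy _]] := cE; have {}cy : c = UNat (ys #0) := cy.
  move: cE fE; rewrite cy nenv_scons.
  rewrite !realizes_graph realizes_rel /= => cE fE.
  by rewrite fE -cE.
rewrite realizes_rel => f0.
apply: (wp_ex (c := UNat 0)); rewrite nenv_scons.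
by apply: wp_and; apply: wp_cst; rewrite realizes_graph.
Qed.

Lemma realized_succ_neq0 :
  realizedN (FImp (@IsSucc 2 #1 #0) (FNot (@IsZero 2 #0))).
Proof.
apply: (realizedN_cst (t := lam $0)) => [|xs sg]; first by inQ.
apply: wp_imp => a; rewrite realizes_graph => E; wps => b bE.
have : rz (@IsZero 2 #0) (nenv xs) b by []; by rewrite realizes_graph -E.
Qed.

Lemma realized_succ_inj :
  realizedN (FImp (FAnd (@IsSucc 3 #2 #0) (@IsSucc 3 #1 #0)) (@FEq 3 #2 #1)).
Proof.
apply: (realizedN_cst (t := lam $0)) => [|xs sg]; first by inQ.
apply: wp_imp => a /realizes_and_exists [[x] + [y]].
rewrite !realizes_graph => <- -[F]; wps.
by rewrite /= /nenv F; constructor.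
Qed.

Lemma realized_proj k' (i : vars k') : realizedN (Graph (PProj i) id i).
Proof.
apply: (realizedN_cst (t := PC k)) => [|xs sg]; first by inQ.
by apply: wp_cst; rewrite realizes_graph.
Qed.

(** In the composition axiom the premises are relations and matter only through their truth, so the
    realizer of the conclusion is a constant, wrapped in as many abstractions as there are
    premises. *)
Lemma realizes_imps n k' (B : form n) e : Q e -> forall h : vars k' -> form n,
  exists2 e', Q e' & forall rho,
  ((forall i, exists a, rz (h i) rho a) -> rz B rho e) ->
  rz (FImps h B) rho e'.
Proof.
move=> Qe; elim: k' => [|k' IH] h /=; first by exists e => // rho; apply; case.
have [e' Qe' e'P] := IH (fun i => h (Some i)).
apply: (poly_realizer C (t := lam (PC e'))); first by inQ.
apply: (wp_lam C) => f fP rho H a aP; apply: fP; wps; apply: e'P => Hh.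
by apply: H => -[i|]; [apply: Hh|exists a].
Qed.

Lemma realized_comp n k' (f : prf k') (g : vars k' -> prf n) :
  realizedN (FImps (fun i => @Graph (k' + n).+1 n (g i)
                 (fun x => Some (vshift k' x)) (Some (@vleft k' n i)))
      (FImp (@Graph (k' + n).+1 k' f (fun i => Some (@vleft k' n i)) #0)
            (@Graph (k' + n).+1 n (PComp f g)
                 (fun x => Some (vshift k' x)) #0))).
Proof.
have [e Qe eP] : exists2 e, Q e & forall x, defined (ap e x) (fun=> True).
  by exists k => // x; apply: definedW (kP C x) _.
set h := fun i => _; set B := FImp _ _.
have [e' Qe' e'P] := realizes_imps B Qe h.
apply: (realizedN_cst (t := PC e')) => [|xs sg]; first by inQ.
apply: wp_cst; apply: e'P => H; rewrite /B realizes_impE => a.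
rewrite !realizes_graph => fE.
apply: definedW (eP a) _ => r _ /=; rewrite -fE.
congr prf_eval; apply/funext => i.
by have [b] := H i; rewrite realizes_graph.
Qed.

Lemma realized_rec0 n (f : prf n) (g : prf n.+2) :
  realizedN (FImp (FAnd (@IsZero n.+2 #1)
                  (@Graph n.+2 n f (fun x => Some (Some x)) #0))
            (@Graph n.+2 n.+1 (PRec f g) Some #0)).
Proof.
apply: (realizedN_cst (t := lam $0)) => [|xs sg]; first by inQ.
apply: wp_imp => a /realizes_and_exists [[x] + [y]].
by rewrite !realizes_graph /= => E F; wps; rewrite /= -E.
Qed.

Lemma realized_recS n (f : prf n) (g : prf n.+2) :
  let par : vars n -> vars n.+4 := fun x => Some (Some (Some (Some x))) in
  realizedN (FImp (FAnd (@IsSucc n.+4 #3 #2)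
            (FAnd (@Graph n.+4 n.+1 (PRec f g) (scons #3 par) #1)
                  (@Graph n.+4 n.+2 g
                     (@scons _ n.+1 #3 (scons #1 par)) #0)))
            (@Graph n.+4 n.+1 (PRec f g) (scons #2 par) #0)).
Proof.
move=> par.
apply: (realizedN_cst (t := lam $0)) => [|xs sg]; first by inQ.
apply: wp_imp =>
  a /realizes_and_exists [[x] + [y /realizes_and_exists [[z] + [w]]]].
rewrite !realizes_graph => /= E F G.
wps; rewrite /= -E -G F; congr prf_eval.
by apply/funext => -[[i|]|].
Qed.

(** Recursion must pass realizers of [A] itself, whereas the base case comes under one quantifier
    over V and the step under two, hence under j. At the base and at each step [stable A] removes
    the jump. The premises on zero and successor are supplied with the dummy [k]. *)
Lemma realized_nat_ind n (A : form n.+1) :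
  realized (FImp
      (FAnd (FAllNat (FImp (@IsZero n.+1 #0) A))
            (FAllNat (FAllNat (FImp (@IsSucc n.+2 #1 #0)
               (FImp (@ren n.+1 n.+2 Some A)
                     (@ren n.+1 n.+2 (omap Some) A))))))
      (FAllNat A)).
Proof.
apply: (realizedI (t := lam (PC ret @@ lam (PC natrec @@
  (PC (stable A) @@ (PC map @@ lam ($0 @@ PC num_zero @@ PC k) @@ ppr0 $1)) @@
  lam (lam (PC (stable A) @@ (PC bind @@
    lam (PC map @@ lam ($0 @@ (PC num_succ @@ $3) @@ PC k @@ $2) @@ ($0 @@
      $2)) @@
    ppr1 $3))) @@ $0)))) => [|rho].
  by inQ.
apply: wp_imp => h; rewrite realizes_andE.
move=> [[h0 [hE0 h0P]] [h1 [hE1 h1P]]]; apply: wp_all => c.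
rewrite /FAllNat realizes_allE in h0P; rewrite /FAllNat realizes_allE in h1P.
apply: wp_imp => a [m [cm /esym aE]]; have {cm}-> : c = UNat m := cm; wps.
apply: (wp_lam C) => f fP; wps; apply: (proj0_defined hE0); wps;
  apply: (wp_lam C) => g gP.
wps; apply: (map_spec (R' := rz A (scons (UNat 0) rho)) h0P) => [d dP|r rP].
  apply: gP; wps; have := dP (UNat 0);
    rewrite !realizes_impE => /(_ num_zero) [|r].
    by exists 0; rewrite num_zeroE.
  move=> [-> rP]; exists r; split=> //; apply: (rP k).
  by exists (fun=> 0); split=> // -[].
wps; apply: definedW (stable_spec rP) _ => r' r'P; wps.
apply: (natrec_spec (R := fun m => rz A (scons (UNat m) rho))) =>
  // p x b px bP.
apply: fP; apply: (wp_lam C) => f' f'P; apply: f'P; wps.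
apply: (proj1_defined hE1); wps; apply: (wp_lam C) => u uP; wps.
apply: (bind_spec (R' := rz A (scons (UNat p.+1) rho)) h1P) => [d dP|q qP];
  last by wps; apply: stable_spec.
apply: uP; wps.
have := dP (UNat p); rewrite realizes_impE => /(_ x) [|q [-> +]].
  by exists p.
rewrite /FAllNat realizes_allE => qP; exists q; split=> //; wps;
  apply: (wp_lam C) => u' u'P; wps.
apply: (map_spec qP) => [d' d'P|]; last by move=> q'; exact.
apply: u'P; wps; apply: definedW (num_succ_spec px) _ => y yE; wps.
have := d'P (UNat p.+1); rewrite realizes_impE => /(_ y) [|q1 [-> +]].
  by exists p.+1.
rewrite realizes_impE => /(_ k) [|q2 [E +]].
  (* A graph relation lists the value in front of the arguments. *)
  by exists (scons p.+1 (fun=> p)); split=> // -[].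
rewrite realizes_impE !realizes_ren => /(_ b bP) q2P.
exists q1; split=> //; exists q2; split=> //; apply: definedW q2P _ => q3.
by congr (rz A _ q3); apply/funext => -[].
Qed.

(** * Extensionality, set existence and set induction *)

Lemma realized_ext : realized (FAllSet (FAllSet (FImp
  (FAll (FIff (@FMem 3 #0 #2) (@FMem 3 #0 #1))) (@FEq 2 #1 #0)))).
Proof.
apply: (realizedI (t := PC ret @@ lam (PC ret @@ lam (lam (PC map @@
  lam (ppair (lam (ppr0 $1 @@ (PC mem_intro @@ $0))) (lam (ppr1 $1 @@
    (PC mem_intro @@ $0))))
  @@ $0))))) => [|rho]; first by inQ.
apply: wp_allset => a ? sa; apply: wp_allset => b ? sb; apply: wp_imp => h.
rewrite realizes_allE => hP; wps; apply: (wp_lam C) => f fP; wps.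
have eqI r : forallp (j r) (fun d =>
    (forall p c, inpair p c a ->
      defined (lapp ap (p0 (Some d)) (Some p)) (fun r => rmem r c b)) /\
    (forall p c, inpair p c b ->
      defined (lapp ap (p1 (Some d)) (Some p)) (fun r => rmem r c a))) ->
    req r a b by apply: (eqE r sa sb).2.
apply: (map_spec hP) => [d dP|r]; last by move/eqI; exact.
apply: fP; wps; apply: (wp_lam C) => g gP; apply: (wp_lam C) => g' g'P q q0 q1.
rewrite q0 q1; split=> p c pc.
- have [[x [dx xP]] _] := dP c.
  apply: g'P; wps; apply: definedW (mem_intro_spec pc) _ => m mP; wps.
  by apply: (proj0_defined dx); apply: xP.
- have [_ [x [dx xP]]] := dP c.
  apply: gP; wps; apply: definedW (mem_intro_spec pc) _ => m mP; wps.
  by apply: (proj1_defined dx); apply: xP.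
Qed.

(** Indices are pairs of a [t] and an admissible tag, so one [t] may carry many tags. Letting [elt]
    depend on the tag as well is what collection requires. *)
Definition uset_of (T : Type) (tag : T -> baire -> Prop)
    (elt : T -> baire -> universe) : universe :=
  @USet {w : T * baire | tag w.1 w.2} (fun w => (sval w).2)
    (fun w => elt (sval w).1 (sval w).2).

Lemma inpair_uset_of T tag elt p c : inpair p c (@uset_of T tag elt) <->
  exists t, tag t p /\ elt t p = c.
Proof.
split=> [[[[t q] tq] /= [<- <-]]|[t [tp <-]]]; first by exists t.
by exists (exist (fun w : T * baire => tag w.1 w.2) (t, p) tp).
Qed.

(** With [a] tagged by the numeral 0 and [b] by the numeral 1, a realizer of membership in the pair
    is literally a realizer of the disjunction, and the identity serves in both directions. *)
Lemma realized_pairing : realized (FAll (FAll (FExSet (FAll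
  (FIff (@FMem 4 #0 #1) (FOr (@FEq 4 #0 #3) (@FEq 4 #0 #2))))))).
Proof.
apply: (realizedI (t := PC ret @@ (PC ret @@ (PC ret @@ ppair (PC k)
  (PC ret @@ ppair (lam $0) (lam $0)))))) => [|rho]; first by inQ.
apply: wp_all => a; apply: wp_all => b.
apply: (wp_compr (c := uset_of (fun (i : bool) p => num (~~ i) = Some p)
  (fun i _ => if i then a else b))) => // x m.
- move/memE => mP; wps; apply: forallpW mP _ => d.
  move=> [c [[p [dp /inpair_uset_of [i [pE cE]]]] [r [dr rP]]]].
  by case: i pE cE => pE cE; [left|right]; rewrite dp dr -pE; split=> //;
    exists r; rewrite /= cE.
- move=> mP; wps; apply/memE; apply: forallpW mP _ => d.
  move=> [[d0 [r [dr rP]]]|[d0 [r [dr rP]]]].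
  + exists a; rewrite d0 dr; split; last by exists r.
    have [z [zE _]] := num_defined 0; rewrite [X in defined X]zE.
    by exists z; split=> //; apply/inpair_uset_of; exists true.
  + exists b; rewrite d0 dr; split; last by exists r.
    have [z [zE _]] := num_defined 1; rewrite [X in defined X]zE.
    by exists z; split=> //; apply/inpair_uset_of; exists false.
Qed.

Definition uidx (a : universe) : Type := if a is USet X _ _ then X else void.
Definition utag (a : universe) : uidx a -> baire :=
  if a is USet X p c then p else fun i => match i with end.
Definition uelt (a : universe) : uidx a -> universe :=
  if a is USet X p c then c else fun i => match i with end.

Lemma inpairE p c a : inpair p c a <-> exists i, @utag a i = p /\ @uelt a i = c.
Proof. by case: a => //=; split=> // -[[]]. Qed.

(** A tag of the union pairs the tag of an element of [a] with a tag inside that element.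
    Conversely, a y in [a] is only realizably equal to a listed element, and [mem_eq_r] moves x from
    y to that element before its tag is read off. *)
Lemma realized_union : realized (FAllSet (FExSet (FAll
  (FIff (@FMem 3 #0 #1)
        (FEx (FAnd (@FMem 4 #0 #3) (@FMem 4 #1 #0))))))).
Proof.
apply: (realizedI (t := PC ret @@ lam (PC ret @@ ppair (PC k)
  (PC ret @@ ppair
    (lam (PC map @@ lam (ppair (PC mem_intro @@ ppr0 (ppr0 $0))
       (PC ret @@ ppair (ppr1 (ppr0 $0)) (ppr1 $0))) @@ $0))
    (lam (PC bind @@ lam (PC bind @@ lam (PC map @@
        lam (ppair (ppair (ppr0 $1) (ppr0 $0)) (ppr1 $0)) @@
        (PC mem_eq_r @@ ppr1 $0 @@ ppr1 $1)) @@ ppr0 $0) @@ $0)))))) => [|rho].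
  by inQ.
apply: wp_allset => a ? sa.
apply: (wp_compr (c := uset_of
  (fun (w : {i : uidx a & uidx (uelt i)}) p =>
     p0 (Some p) = Some (utag (tag w)) /\ p1 (Some p) = Some (utag (tagged w)))
  (fun w _ => uelt (tagged w)))) => // x m.
- move/memE => mP; wps; apply: (wp_lam C) => f fP; wps.
  apply: (map_spec mP) => [d|r rP]; last by rewrite realizes_exE; apply: rP.
  move=> [c [[p [dp /inpair_uset_of [[i l] /= [[pi pl] cE]]]] [r [dr rP]]]].
  apply: fP; wps; apply: (proj1_defined dr); wps; apply: (proj0_defined dp).
  apply: (proj1_defined pl); wps=> q q0 q1; wps; apply: ret_spec => r' jr'; wps.
  apply: (proj0_defined dp); apply: (proj0_defined pi); wps.
  apply: definedW (@mem_intro_spec _ (uelt i) a _) _; first by apply/inpairE;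
    exists i.
  move=> m1 m1P v v0 v1; exists (uelt i).
  split; first by rewrite v0; exists m1.
  rewrite v1; exists r'; split=> //=; apply: (rmem_intro jr' q0 q1 _ rP).
  by apply/inpairE; exists l.
- rewrite realizes_exE => mP; wps; apply: (wp_lam C) => f fP; wps.
  apply: (bind_spec mP) => [d [y]|r rP]; last by apply/memE; apply: rP.
  rewrite realizes_andE => -[[m0 [dm0 /memE m0P]] [m1 [dm1 m1P]]].
  apply: fP; wps; apply: (proj0_defined dm0); wps; apply: (wp_lam C) => g gP;
    wps.
  apply: (bind_spec m0P) => [d' [y' [[q [dq qy]] [e [de eP]]]]|r]; last exact.
  apply: gP; wps; apply: (proj1_defined dm1); wps; apply: (proj1_defined de).
  wps; apply: defined2W (mem_eq_r_spec eP m1P) _ => m2 /memE m2P; wps.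
  apply: (wp_lam C) => h hP; wps.
  apply: (map_spec m2P) => [d'' [w [[q' [dq' qw]] [e' [de' e'P]]]]|r];
    last exact.
  apply: hP; wps; apply: (proj1_defined de'); wps; apply: (proj0_defined dq').
  wps; apply: (proj0_defined dq) => t t0 t1 v v0 v1.
  exists w; rewrite v0 v1; split; last by exists e'.
  exists t; split=> //; apply/inpair_uset_of.
  move/inpairE: qy => [i [iq iy]]; subst y'; move/inpairE: qw => [l [lq lw]].
  by exists (Tagged (fun i => uidx (uelt i)) l); rewrite t0 t1 -iq -lq.
Qed.

(* A subset of a is represented by a set S of pairs (r, i) with i an index of
   a, where r is required to determine the tag of the i-th element of a. *)
Lemma realized_powerset : realized (FAllSet (FExSet (FAll
  (FIff (@FMem 3 #0 #1)
        (FAnd (@FSet 3 #0)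
              (FAll (FImp (@FMem 4 #0 #1) (@FMem 4 #0 #3)))))))).
Proof.
apply: (realizedI (t := PC ret @@ lam (PC ret @@ ppair (PC k)
  (PC ret @@ ppair
    (lam (ppair (PC k) (PC map @@ lam (lam (PC map @@
      lam (ppair (ppr0 (ppr0 $0)) (ppr1 $0)) @@ (PC mem_eq_r @@ ppr1 $1 @@
        $0))) @@
      $0)))
    (lam (PC map @@ lam (ppair (PC k) (PC ret @@ ppair
      (lam (PC map @@ lam (ppair (ppair (ppr0 $0) (ppair $1 (ppr1 $0)))
         (ppr1 $0)) @@ ($1 @@ (PC mem_intro @@ $0))))
      (lam (PC ret @@ ppair (ppr0 (ppr1 $0)) (PC req_sym @@ ppr1 (ppr1 $0))))))
      @@ ppr1 $0)))))) => [|rho].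
  by inQ.
apply: wp_allset => a ? sa.
pose sub (S : baire -> uidx a -> Prop) := uset_of
  (fun i r => S r i /\ p0 (Some r) = Some (utag i)) (fun i _ => uelt i).
apply: (wp_compr (c := uset_of (fun (_ : baire -> uidx a -> Prop) _ => True)
  (fun S _ => sub S))) => // x m.
- move/memE => mP; apply: wp_and; last first.
    apply: wp_cst.
    have [d [c [[p [_ /inpair_uset_of [S [_ <-]]]] [r [_ rP]]]]] :=
      forallp_ex mP.
    by apply: (req_uset rP).2.
  wps; apply: (wp_lam C) => f fP; wps.
  apply: (map_spec mP) => [d|r rP]; last by rewrite realizes_allE; apply: rP.
  move=> [c [[p [_ /inpair_uset_of [S [_ <-]]]] [e [de eP]]]].
  apply: fP; apply: (wp_lam C) => g gP z; rewrite realizes_impE => m' m'P;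
    apply: gP.
  wps; apply: (proj1_defined de); wps.
  apply: defined2W (mem_eq_r_spec eP m'P) _ => m1 /memE m1P; wps.
  apply: (wp_lam C) => h hP; wps.
  apply: (map_spec m1P) => [d'|r rP]; last by apply/memE; apply: rP.
  move=> [c' [[p' [dp' /inpair_uset_of [i [[_ pi] <-]]]] [e' [de' e'P]]]].
  apply: hP; wps; apply: (proj1_defined de'); wps; apply: (proj0_defined dp').
  apply: (proj0_defined pi) => v v0 v1; exists (uelt i); rewrite v0 v1.
  split; last by exists e'.
  by exists (utag i); split=> //; apply/inpairE; exists i.
- rewrite realizes_andE => -[[z [_ sx]] [m1 [mm1]]].
  have {}sx : is_uset x := sx; rewrite realizes_allE.
  move=> m1P; wps; apply: (proj1_defined mm1); wps; apply: (wp_lam C) => f fP;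
    wps.
  apply: (map_spec m1P) => [d dP|r rP]; last by apply/memE; apply: rP.
  apply: fP; wps; apply: (wp_lam C) => g gP;
    apply: (wp_lam C) => h hP q q0 q1; wps.
  apply: ret_spec => r jr; wps=> v v0 v1.
  (* Besides the tag of i, an r in [S] stores a tag p of some z in x and a realizer e of z = a_i.
     From these, an element of [sub S] is sent back into x without further information. *)
  pose S r i := exists p z e, [/\ defined (p1 (Some r)) (fun r1 =>
    p0 (Some r1) = Some p /\ p1 (Some r1) = Some e),
    inpair p z x & req e z (@uelt a i)].
  exists (sub S); rewrite v0 v1; split.
    by exists k; split=> //; apply/inpair_uset_of; exists S.
  exists r; split=> //; apply: (req_intro jr q0 q1) => // p c.
  + move=> pc; apply: hP; wps;
      apply: definedW (mem_intro_spec pc) _ => m2 m2P; wps.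
    have := dP c; rewrite realizes_impE => /(_ m2 m2P) /definedW; apply.
    move=> m3 /memE m3P; wps; apply: (wp_lam C) => u uP; wps.
    apply: (map_spec m3P) => [d'|r' rP]; last by apply/memE; apply: rP.
    move=> [c' [[p' [dp' /inpairE [i [ip ic]]]] [e' [de' e'P]]]].
    apply: uP; wps; apply: (proj1_defined de'); wps; apply: (proj1_defined de').
    wps=> w w0 w1; wps; apply: (proj0_defined dp') => w' w'0 w'1 y y0 y1.
    exists c'; rewrite y0 y1; split; last by exists e'.
    exists w'; split=> //; apply/inpair_uset_of; exists i; split=> //.
    rewrite w'0 ip; split=> //; exists p, c, e'; rewrite ic; split=> //.
    by exists w.
  + move=> /inpair_uset_of [i [[[p' [z' [e [[r1 [pr1 [r10 r11]]] zx eP]]]] _] <-]].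
    apply: gP; wps; apply: (proj1_defined pr1); apply: (proj1_defined r11); wps.
    apply: definedW (req_sym_spec e) _ => e' /(_ _ _ eP) e'P; wps.
    apply: (proj1_defined pr1); apply: (proj0_defined r10) => w w0 w1; wps.
    by apply: ret_spec => r' jr'; apply: (rmem_intro jr' w0 w1 zx).
Qed.

Lemma realized_infinity :
  realized (FExSet (FAll (FIff (@FMem 2 #0 #1) (@FNat 2 #0)))).
Proof.
apply: (realizedI (t := PC ret @@ ppair (PC k) (PC ret @@ ppair
  (lam (PC ext @@ (PC map @@ lam (ppr0 $0) @@ $0))) (lam (PC mem_intro @@
    $0)))))
  => [|rho]; first by inQ.
apply: (wp_compr (c := uset_of (fun n p => num n = Some p)
  (fun n _ => UNat n))) => // x m.
- move/memE => mP; wps; apply: (wp_lam C) => f fP; wps.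
  have [d [c [[p [_ /inpair_uset_of [n [np <-]]]] [r [_ rP]]]]] :=
    forallp_ex mP.
  (* One element of j(m) determines x as a number n; then every element has the numeral of n as its
     tag, and [ext] can evaluate the singleton of tags. *)
  have xn := req_nat_r rP; subst x.
  apply: (map_spec (R' := eq p) mP) => [d'|r' r'P]; last first.
    by wps; apply: (ext_spec r'P); exists n.
  move=> [c' [[p' [dp' /inpair_uset_of [n' [np' <-]]]] [r' [_ r'P]]]].
  have [nn] := req_nat_l r'P; subst n'.
  apply: fP; wps; apply: (proj0_defined dp').
  by move: np'; rewrite np => -[].
- move=> [n [xn mE]]; have {xn}-> : x = UNat n := xn.
  by wps; apply: mem_intro_spec; apply/inpair_uset_of; exists n.
Qed.

(** A realizable element of [a] need not be one of its listed elements, only equal to one. The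
    structural induction therefore runs over a set b realizably equal to [a]: a member of [a] is
    then equal to a listed element of b. *)
Lemma rmem_wf a : Acc (fun y x => exists m, rmem m y x) a.
Proof.
suff H b e : req e a b -> Acc (fun y x => exists m, rmem m y x) a.
  exact: H (req_refl_spec a).
elim: b a e => [n|X p c IH] a e eP; constructor=> y [m mP].
  by rewrite (req_nat_r eP) in mP; have := rmem_uset mP.
have [g [_ [m' [_ /memE /forallp_ex [d]]]]] := mem_eq_r_spec eP mP.
by move=> [z [[q [_ [i [_ <-]]]] [r [_ rP]]]]; apply: IH rP.
Qed.

Lemma realized_set_ind n (A : form n.+1) : realized (FImp
  (FAll (FImp
     (FAll (FImp (@FMem n.+2 #0 #1) (@ren n.+1 n.+2 (omap Some) A))) A))
  (FAll A)).
Proof.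
apply: (realizedI (t := lam (PC map @@ lam (PC fixc @@
  lam (lam ($2 @@ (PC ret @@ lam ($2 @@ $0)))) @@ PC k) @@ $0))) => [|rho].
  by inQ.
apply: wp_imp => h; rewrite realizes_allE => hP; wps;
  apply: (wp_lam C) => f fP; wps.
apply: (map_spec hP) => [d dP|r rP]; last by rewrite realizes_allE; apply: rP.
apply: fP; wps; apply: (wp_lam C) => F FP; wps.
apply: definedW (fixc_spec F) _ => G GP.
apply: (defined_forall (UNat 0)) => c.
(* The body ignores the argument of [G]: it is [k] at the top and the realizer of membership in the
   recursive calls, so all [z] are treated together. *)
suff: forall z, defined (ap G z) (rz A (scons c rho)) by apply.
elim/Acc_ind: c / (rmem_wf c) => c _ IH z.
apply: GP; apply: FP; apply: (wp_lam C) => g gP; apply: gP; wps.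
apply: (wp_lam C) => u uP; wps; apply: ret_spec => r jr; wps.
have := dP c; rewrite realizes_impE => /(_ r); apply.
rewrite realizes_allE; apply: forallpW jr _ => _ <- y; rewrite realizes_impE.
move=> m mP; apply: uP; wps; rewrite realizes_ren.
apply: definedW (IH y _ m) _ => [|r' ]; first by exists m.
by congr (rz A _ r'); apply/funext => -[].
Qed.

(** A tag pairs the tag of an element of [a] with a realizer of [A] there. Since x is only equal to
    that element, the realizer of [A] is moved by [subst_eq] along the first variable, which the
    mask [mk] marks; the result, obtained under j, is released by [stable A]. *)
Lemma realized_separation n (A : form n.+2) :
  realized (FAllSet (FExSet (FAll
      (FIff (@FMem n.+3 #0 #1)
            (FAnd (@FMem n.+3 #0 #2)
                  (@ren n.+2 n.+3 (omap Some) A)))))).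
Proof.
pose mk : vars n.+2 -> bool := scons true (fun=> false).
apply: (realizedI (t := PC ret @@ lam (PC ret @@ ppair (PC k)
  (PC ret @@ ppair
    (lam (ppair (PC map @@ lam (ppair (ppr0 (ppr0 $0)) (ppr1 $0)) @@ $0)
       (PC (stable A) @@ (PC map @@
          lam (PC (subst_eq A mk) @@ (PC req_sym @@ ppr1 $0) @@
            ppr1 (ppr0 $0)) @@ $0))))
    (lam (PC map @@ lam (ppair (ppair (ppr0 $0)
       (PC (subst_eq A mk) @@ ppr1 $0 @@ ppr1 $1)) (ppr1 $0)) @@
         ppr0 $0)))))) => [|rho].
  by inQ.
apply: wp_allset => a ? sa.
have scE x b : (fun i => scons x (scons b (scons a rho)) (omap Some i)) =
    scons x (scons a rho) :> (vars n.+2 -> universe).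
  by apply/funext => -[[]|].
apply: (wp_compr (c := uset_of (fun (i : uidx a) v =>
    p0 (Some v) = Some (utag i) /\
    defined (p1 (Some v)) (rz A (scons (uelt i) (scons a rho))))
  (fun i _ => uelt i))) => // x m.
- move/memE => mP; apply: wp_and; last first.
    wps; apply: (wp_lam C) => f fP; wps.
    apply: (map_spec mP) => [d|r rP]; last by apply/memE; apply: rP.
    move=> [c [[p [dp /inpair_uset_of [i [[pi _] <-]]]] [e [de eP]]]].
    apply: fP; wps; apply: (proj1_defined de); wps; apply: (proj0_defined dp).
    apply: (proj0_defined pi) => v v0 v1; exists (uelt i); rewrite v0 v1.
    split; last by exists e.
    by exists (utag i); split=> //; apply/inpairE; exists i.
  rewrite realizes_ren scE; wps; apply: (wp_lam C) => f fP; wps.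
  apply: (map_spec (R' := rz A (scons x (scons a rho))) mP) => [d|r rP];
    last by wps; apply: stable_spec.
  move=> [c [[p [dp /inpair_uset_of [i [[_ [r [pr rP]]] <-]]]] [e [de eP]]]].
  apply: fP; wps; apply: (proj0_defined dp); apply: (proj1_defined pr); wps.
  apply: (proj1_defined de); wps.
  apply: definedW (req_sym_spec e) _ => e' /(_ _ _ eP) e'P; wps.
  by apply: (subst_eq_spec _ rP) => -[i'|].
- rewrite realizes_andE realizes_ren scE =>
    -[[m0 [mm0 /memE m0P]] [r [mr1 rP]]].
  wps; apply: (proj0_defined mm0); wps; apply: (wp_lam C) => f fP; wps.
  apply: (map_spec m0P) => [d|r' r'P]; last by apply/memE; apply: r'P.
  move=> [c [[p [dp /inpairE [i [ip ic]]]] [e [de eP]]]].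
  apply: fP; wps; apply: (proj1_defined de); wps; apply: (proj1_defined mr1).
  wps; apply: (proj1_defined de); wps.
  apply: defined2W (@subst_eq_spec _ A mk _ (scons c (scons a rho)) e r _ rP) _.
    by case.
  move=> r' r'P; wps; apply: (proj0_defined dp) => w w0 w1 v v0 v1.
  exists c; rewrite v0 v1; split; last by exists e.
  exists w; split=> //; apply/inpair_uset_of; exists i; rewrite w0 w1 ip ic.
  by split=> //; split=> //; exists r'.
Qed.

(** The jump of an existential realizer may contain many v, with different witnesses. So a y is
    chosen for each pair of an index i and a realizer v of the existence at that element, and v
    itself becomes the tag of the chosen y in [b]. The mask [mk] marks x and leaves y alone. *)
Lemma realized_collection n (A : form n.+3) :
  realized (FAllSet (FImp
      (FAll (FImp (@FMem n.+2 #0 #1) (FEx A)))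
      (FExSet (FAll (FImp (@FMem n.+3 #0 #2)
         (FEx (FAnd (@FMem n.+4 #0 #2)
                    (@ren n.+3 n.+4 (omap (omap Some)) A)))))))).
Proof.
pose mk : vars n.+3 -> bool := scons false (@scons _ n.+1 true (fun=> false)).
apply: (realizedI (t := PC ret @@ lam (lam (PC map @@ lam (ppair (PC k)
  (PC ret @@ lam (PC bind @@ lam (PC map @@ lam (ppair (PC mem_intro @@ $0)
     (PC (subst_eq A mk) @@ (PC req_sym @@ ppr1 $1) @@ $0)) @@
     ($2 @@ (PC mem_intro @@ ppr0 $0))) @@ $0))) @@ $0)))) => [|rho].
  by inQ.
apply: wp_allset => a ? sa; apply: wp_imp => h; rewrite realizes_allE => hP.
pose env y x : vars n.+3 -> universe := scons y (scons x (scons a rho)).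
pose good i v := exists y, rz A (env y (@uelt a i)) v.
(* The default value never enters [b], whose tags are exactly the good pairs. *)
pose wit i v := if pselect (good i v) is left gv then projT1 (cid gv)
  else UNat 0.
pose b := uset_of good wit.
wps; apply: (wp_lam C) => f fP; wps.
apply: (map_spec hP) => [d dP|r rP]; last first.
  by rewrite /FExSet realizes_exE; apply: rP.
apply: fP; wps; apply: (wp_lam C) => g gP; wps; apply: ret_spec => r jr;
  wps=> v v0 v1.
exists b; rewrite realizes_andE v0 v1; split; first by exists k.
exists r; split=> //; rewrite realizes_allE; apply: forallpW jr _ => _ <- x.
rewrite realizes_impE => m /memE mP; apply: gP; wps;
  apply: (wp_lam C) => u uP; wps.
apply: (bind_spec mP) => [d'|r' r'P]; last by rewrite realizes_exE; apply: r'P.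
move=> [c [[p [dp /inpairE [i [ip ic]]]] [e [de eP]]]].
apply: uP; wps; apply: (proj0_defined dp); wps.
apply: definedW (@mem_intro_spec _ (uelt i) a _) _; first by apply/inpairE;
  exists i.
move=> m1 m1P; wps; have := dP (uelt i); rewrite realizes_impE => /(_ m1 m1P).
move=> /definedW; apply=> m2; rewrite realizes_exE => m2P; wps.
apply: (wp_lam C) => u' u'P; wps.
apply: (map_spec m2P) => [w wP|r']; last exact.
have {}wP : good i w by have [y yP] := wP; exists y.
have yP : rz A (env (wit i w) (uelt i)) w.
  by rewrite /wit; case: pselect => // gw; case: (cid gw).
apply: u'P; wps; apply: (proj1_defined de); wps.
apply: definedW (req_sym_spec e) _ => e' /(_ _ _ eP) e'P; wps.
apply: defined2W (@subst_eq_spec _ A mk _ (env (wit i w) x) e' w _ yP) _.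
  by rewrite -ic in e'P; case=> [[]|].
move=> q qP; wps; apply: definedW (@mem_intro_spec _ (wit i w) b _) _.
  by apply/inpair_uset_of; exists i.
move=> q' q'P t t0 t1; exists (wit i w); rewrite realizes_andE t0 t1.
split; first by exists q'.
exists q; split=> //; rewrite realizes_ren; move: qP.
by congr (rz A _ q); apply/funext => -[[[]|]|].
Qed.

End Algebra.

Theorem theorem2p6 (P : set baire) (ap : papp) (j : mmap)
    (hP : relative_pca P ap) (hj : idempotent_jump P ap j)
    (s k : baire) (hPj : combinators (jpart P j) (japp ap j) s k)
    (A : sentence) (hA : IZF A) :
  jrealizable P ap j s k A.
Proof.
have [ret [map [join [lift M]]]] := jump_monad_jpart hj hP.
suff [e Qe eA] : realized (jpart P j) (japp ap j) j s k A by exists e.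
case: hA => *.
- exact: (close_realized hPj M (realized_refl hPj M)).
- exact: (close_realized hPj M (realized_leibniz hPj M _)).
- exact: (close_realized hPj M (realized_nat_set j hPj)).
- exact: (close_realized hPj M (realized_mem_set j hPj)).
- exact: (closeN_realized hPj M (realized_graph_total hPj M _)).
- exact: (closeN_realized hPj M (realized_graph_uniq j hPj _)).
- exact: (closeN_realized hPj M (realized_rel_graph hPj M _)).
- exact: (closeN_realized hPj M (realized_succ_neq0 j hPj)).
- exact: (closeN_realized hPj M (realized_succ_inj j hPj)).
- exact: (closeN_realized hPj M (realized_proj j hPj _)).
- exact: (closeN_realized hPj M (realized_comp j hPj _ _)).
- exact: (closeN_realized hPj M (realized_rec0 j hPj _ _)).
- exact: (closeN_realized hPj M (realized_recS j hPj _ _)).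
- exact: (close_realized hPj M (realized_nat_ind hPj M _)).
- exact: (realized_ext hPj M).
- exact: (realized_pairing hPj M).
- exact: (realized_union hPj M).
- exact: (realized_powerset hPj M).
- exact: (realized_infinity hPj M).
- exact: (close_realized hPj M (realized_set_ind hPj M _)).
- exact: (close_realized hPj M (realized_separation hPj M _)).
- exact: (close_realized hPj M (realized_collection hPj M _)).
Qed.
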